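(* Let $G_1=(V_1,\mathcal E_1)$ be a finite connected oriented graph with distinguished vertices $a_1,b_1$ such that $d_1(a_1,b_1)>1$ and there exist at least two edge-disjoint paths connecting $a_1$ to $b_1$ in $G_1$. Let $p_\star$ be the unique fixed point of $f_1$ in $(0,1)$ and let $d_f$ be the dimension of the critical cluster. Then, for percolation on $G_k$ at $p=p_\star$, $$\frac{|\mathcal C_{\{a_k,b_k\}}|}{d_f^k}$$ converges in distribution as $k\to\infty$ to a probability distribution supported on $(0,\infty)$.
   Context: $G_1=(V_1,\mathcal E_1)$ is a finite connected oriented graph (a finite simple graph with an orientation chosen for each edge), with two distinguished vertices $a_1,b_1$. An edge $e$ is written $e=(e_-,e_+)$. Distances, paths and connectivity ignore orientation; $d_1$ is the graph distance in $G_1$. Hierarchical graphs: $G_0$ is a single oriented edge $(a_0,b_0)$. Given $G_k=(V_k,\mathcal E_k)$ with distinguished vertices $a_k,b_k$, $G_{k+1}$ is obtained by replacing each oriented edge $(x,y)\in\mathcal E_k$ by a fresh copy of $G_1$, with $a_1$ identified with $x$ and $b_1$ with $y$; $a_{k+1},b_{k+1}$ are the vertices that were $a_k,b_k$. Percolation: under $\mathbb P^k_p$ each edge of $G_k$ is independently open with probability $p$ and closed otherwise. $f_1(p)=\mathbb P^1_p(a_1\leftrightarrow b_1)$; under the stated hypothesis $f_1$ has exactly one fixed point $p_\star$ in $(0,1)$. $\mathcal C_{\{a_k,b_k\}}$ is the set of edges $e\in\mathcal E_k$ such that at least one endvertex of $e$ is connected by an open path (possibly of length zero) to $a_k$ or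 $b_k$. The constant $d_f$: it is the largest (Perron–Frobenius) eigenvalue of the $3\times3$ matrix $M(p_\star)$, where $M(p)=\sum_{e'\in\mathcal E_1}M^{e'}(p)$ and, writing $\mathbb P^{1,e'}_p$ for percolation on $G_1$ with edge $e'$ removed and $S_1=\{e'_-\}$, $S_2=\{e'_+\}$, $S_3=\{e'_-,e'_+\}$, the entries are $M^{e'}_{1j}=\mathbb P^{1,e'}_p(S_j\leftrightarrow a_1,\ S_j\not\leftrightarrow b_1)$, $M^{e'}_{2j}=\mathbb P^{1,e'}_p(S_j\not\leftrightarrow a_1,\ S_j\leftrightarrow b_1)$, $M^{e'}_{3j}=\mathbb P^{1,e'}_p(S_j\leftrightarrow a_1,\ S_j\leftrightarrow b_1)$. (A set is connected to a vertex if at least one of its elements is.) Equivalently, $d_f$ is the unique positive number such that $\mathbb E^k_{p_\star}[|\mathcal C_{\{a_k,b_k\}}|]/d_f^k$ is bounded above and below by positive constants uniformly in $k$. *)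

(* Defs.v *)
From HB Require Import structures.
From mathcomp Require Import all_boot all_order all_algebra.
From mathcomp Require Import all_classical all_reals all_analysis.
From mathcomp Require Import complex.

Set Implicit Arguments.
Unset Strict Implicit.
Unset Printing Implicit Defensive.

Import Order.TTheory GRing.Theory Num.Theory numFieldNormedType.Exports.

Local Open Scope classical_set_scope.
Local Open Scope ring_scope.

(* The container allows loops and parallel edges; [simple_graph] excludes them. *)
Record ograph := OGraph {
  vertex : finType;
  edge : finType;
  src : edge -> vertex;
  tgt : edge -> vertex;
  ra : vertex;
  rb : vertex }.

Section Graph.
Variable G : ograph.
Implicit Types (x y : vertex G) (e : edge G) (w : {set edge G}).

Definition ends e : {set vertex G} := [set src e; tgt e]%SET.

Definition simple_graph : Prop :=
  (forall e, src e <> tgt e) /\ injective ends.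

(* Adjacency through an edge of w, ignoring the orientation. *)
Definition adj w : rel (vertex G) :=
  [rel x y | [exists e in w, [|| (src e == x) && (tgt e == y)
                               | (src e == y) && (tgt e == x)]]].

Definition linked w x y : bool := connect (adj w) x y.

Definition connected_graph : Prop := forall x y, linked [set: edge G]%SET x y.

(* Least length of a path from x to y; a shortest path has fewer than
   #|vertex G| edges, so the value is #|vertex G| exactly when x and y are
   not connected. *)
Definition gdist x y : nat :=
  find (fun n => [exists s : n.-tuple (vertex G),
                    path (adj [set: edge G]%SET) x s && (last x s == y)])
       (iota 0 #|vertex G|).

Definition is_path x (s : seq (vertex G)) y : bool :=
  [&& path (adj [set: edge G]%SET) x s, last x s == y & uniq (x :: s)].

(* In a simple graph an edge is determined by its endvertices. *)
Definition path_edges x (s : seq (vertex G)) : {set edge G} :=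
  [set e | ends e \in pairmap (fun u v => [set u; v]%SET) x s]%SET.

Definition two_edge_disjoint_paths x y : Prop :=
  exists s1 s2, [/\ is_path x s1 y, is_path x s2 y
    & path_edges x s1 :&: path_edges x s2 = finset.set0].

Definition linked_set w (S : {set vertex G}) y : bool :=
  [exists x in S, linked w x y].

Definition root_cluster w : {set edge G} :=
  [set e | [exists x in ends e, linked_set w [set ra G; rb G]%SET x]]%SET.

End Graph.

(* Bernoulli(p) bond percolation: w is the (finite) set of open edges, so
   expectations and probabilities are finite sums. *)
Section Percolation.
Variables (R : realType) (G : ograph) (p : R).

Definition perc_weight (w : {set edge G}) : R :=
  \prod_(e : edge G) (if e \in w then p else 1 - p).

Definition perc_expect (X : {set edge G} -> R) : R :=
  \sum_(w : {set edge G}) perc_weight w * X w.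

Definition perc_prob (A : pred {set edge G}) : R :=
  \sum_(w : {set edge G} | A w) perc_weight w.

End Percolation.

Definition cross_prob (R : realType) (G : ograph) (p : R) : R :=
  perc_prob p [pred w | linked w (ra G) (rb G)].

Definition single_edge : ograph :=
  @OGraph bool unit (fun=> false) (fun=> true) false true.

Section Replace.
Variables G H : ograph.

Definition inner : finType := {v : vertex H | (v != ra H) && (v != rb H)}.

(* Image of the vertex v of H in the copy of H replacing the edge e of G. *)
Definition glue_vertex (e : edge G) (v : vertex H) : vertex G + edge G * inner :=
  if insub v is Some u then inr (e, u)
  else inl (if v == ra H then src e else tgt e).

Definition subst_graph : ograph :=
  @OGraph (vertex G + edge G * inner)%type (edge G * edge H)%type
    (fun e => glue_vertex e.1 (src e.2)) (fun e => glue_vertex e.1 (tgt e.2))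
    (inl (ra G)) (inl (rb G)).

End Replace.

Fixpoint hgraph (G1 : ograph) (k : nat) : ograph :=
  if k is k'.+1 then subst_graph (hgraph G1 k') G1 else single_edge.

Definition remove_edge (G : ograph) (e' : edge G) : ograph :=
  @OGraph (vertex G) {e : edge G | e != e'}
    (fun e => src (val e)) (fun e => tgt (val e)) (ra G) (rb G).

Section MeanMatrix.
Variables (R : realType) (G : ograph) (p : R).

(* The indices 0, 1, 2 below stand for 1, 2, 3. *)
Definition root_set (e' : edge G) (j : 'I_3) : {set vertex G} :=
  nth finset.set0 [:: [set src e']; [set tgt e']; [set src e'; tgt e']]%SET j.

Definition mean_event (e' : edge G) (i j : 'I_3) :
    pred {set edge (remove_edge e')} :=
  [pred w | let to_a := @linked_set (remove_edge e') w (root_set e' j) (ra G) in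
            let to_b := @linked_set (remove_edge e') w (root_set e' j) (rb G) in
            nth false [:: to_a && ~~ to_b; ~~ to_a && to_b; to_a && to_b] i].

Definition mean_matrix : 'M[R]_3 :=
  \sum_(e' : edge G) \matrix_(i, j) perc_prob p (@mean_event e' i j).

End MeanMatrix.

(* Perron-Frobenius eigenvalue: an eigenvalue that is largest in modulus among
   the complex eigenvalues. *)
Definition is_PF_eigenvalue (R : realType) (n : nat) (A : 'M[R]_n) (d : R) :
    Prop :=
  eigenvalue A d /\
  forall z : R[i], eigenvalue (map_mx (real_complex R) A) z -> `|z| <= d%:C%C.

(* Weak convergence of the laws of the random variables X k, defined on
   percolation configurations of G k at parameter p, to mu. *)
Definition cvg_in_distribution (R : realType) (G : nat -> ograph) (p : R)
    (X : forall k, {set edge (G k)} -> R)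
    (mu : probability (measurableTypeR R) R) : Prop :=
  forall h : R -> R,
    continuous h -> (exists B : R, forall x, `|h x| <= B) ->
    perc_expect p (fun w => h (X k w)) @[k --> \oo] --> \int[mu]_x h x.

(* Main.v *)
Require Import Defs.
From HB Require Import structures.
From mathcomp Require Import all_boot all_order all_algebra.
From mathcomp Require Import all_classical all_reals all_analysis.
From mathcomp Require Import complex measurable_realfun.
From mathcomp Require Import ring lra.

(** The cluster of the two terminals evolves as a multitype branching process.
    $G_{k+1}$ is $G_k$ with every edge replaced by a copy of $G_1$.  Since
    $p_\star$ is a fixed point of the crossing probability, the edges whose copy
    is crossed form a percolation of the same parameter on $G_k$ and, given this
    percolation, the copies are independent, each conditioned to be crossed or
    not ([perc_expect_subst]).  A vertex of a copy is joined to the terminals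
    exactly when it is joined, inside the copy, to an endvertex of the replaced
    edge that is itself joined to them ([linked_subst]).  So let the type of an
    edge record whether it is open and which of its endvertices are reached from
    the terminals: the types found inside a copy depend only on the copy and on
    the type of the edge that it replaces ([status_subst]), and the cluster
    consists of the edges with at least one reached endvertex.

    Growth rate.  Let $y_k(t)$ be the mean number of cluster edges descending in
    $k$ generations from an edge of type $t$.  Every reached edge may produce an
    open edge, and an open edge may produce a closed edge with both endvertices
    reached; the second fact is where edge-disjoint paths enter.  This gives a
    Harnack inequality ([harnack]), by which the ratios $y_{k+1}(t)/y_k(t)$
    converge geometrically fast to one number $\rho$, the same for all types
    ([ratio_limit], [mean_cluster_growth]).  If the state of an edge is averaged
    out, given the connections made by the other edges, the recursion for the
    means becomes multiplication by the mean matrix ([endpoint_form_mean]).  The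
    mean cluster size therefore satisfies the linear recurrence given by the
    Cayley-Hamilton theorem, which makes $\rho$ an eigenvalue, and it dominates
    the powers of the matrix, so no real eigenvalue exceeds $\rho$; hence
    $\rho = d_f$ ([growth_rate_eigenvalue]).

    Convergence.  Couple the generations by the passage from $G_{k+1}$ to $G_k$.
    The increment of the normalised cluster size is the sum of a fluctuation,
    whose variance is of the order of the population divided by $\rho^{2k}$, and
    of the error made in replacing the one-step mean by exact growth at rate
    $\rho$, which becomes geometrically small relative to the population.  So the
    increments decay geometrically in mean ([increment_le]).  The finite probability spaces are
    realised together on the unit interval, where the normalised sizes then
    converge almost everywhere; the law of the limit is the weak limit
    ([tower_limit]).

    No mass at zero.  Both terminals of $G_1$ have degree at least two, so each
    reached edge has at least two reached descendants and the generating function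
    of the offspring squares every bound below one ([genfun_square]).  Its
    iterates started at a distance of about $\eta\rho^{-n}$ from one are bounded
    away from one after $n$ steps ([genfun_bounded_away]), and $m$ further steps
    bring them below $q^m$ for some $q < 1$.  This bounds the Laplace transforms of the normalised sizes at
    $\eta\rho^m$ uniformly in the generation ([laplace_small]), so the limit law
    gives no mass to the nonpositive numbers ([laplace_null]). *)

Set Implicit Arguments.
Unset Strict Implicit.
Unset Printing Implicit Defensive.

Import Order.TTheory GRing.Theory Num.Theory numFieldNormedType.Exports.
Local Open Scope ring_scope.

(** * Connectivity in a substituted graph *)

Section Connectivity.
Variable G : ograph.
Implicit Types (x y z : vertex G) (e : edge G) (w : {set edge G}).

Lemma adj_sym w : symmetric (adj w).
Proof.
move=> x y; rewrite /adj /=; apply: eq_existsb => e.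
by rewrite orbC [in RHS]orbC; congr (_ && _); rewrite orbC.
Qed.

Lemma linked_sym w x y : linked w x y = linked w y x.
Proof. exact: (sym_connect_sym (@adj_sym w)). Qed.

Lemma linked_refl w x : linked w x x.
Proof. exact: connect0. Qed.

Lemma linked_trans w y x z : linked w x y -> linked w y z -> linked w x z.
Proof. exact: connect_trans. Qed.

Lemma linked_edge w e : e \in w -> linked w (src e) (tgt e).
Proof.
move=> ew; apply: connect1; apply/existsP; exists e.
by rewrite ew !eqxx.
Qed.

Lemma linked_ind w (P : pred (vertex G)) x y :
  (forall e, e \in w -> P (src e) = P (tgt e)) ->
  linked w x y -> P x = P y.
Proof.
move=> Pw /connectP[s + ->].
elim: s x => [|z s IH] x //= /andP[/existsP[e /andP[ew exz]] /IH <-].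
by case/orP: exz => /andP[/eqP <- /eqP <-]; rewrite (Pw e).
Qed.

Lemma linkedS w w' x y : w \subset w' -> linked w x y -> linked w' x y.
Proof.
move=> ww' xy; rewrite -(@linked_ind w (linked w' x) x y) ?linked_refl // => e.
move=> /(fintype.subsetP ww') /linked_edge ew'.
apply/idP/idP => h; first exact: linked_trans h ew'.
by apply: linked_trans h _; rewrite linked_sym.
Qed.

(** Connection to a prescribed subset of the two terminals, encoded by a pair
    of booleans: an edge of the cluster may hand down to the copy of $G_1$ that
    replaces it only one connected endvertex. *)
Definition reached (r : bool * bool) w x : bool :=
  r.1 && linked w (ra G) x || r.2 && linked w (rb G) x.

(** Whether the edge is open, and which endvertices are reached. *)
Definition etype : Type := (bool * (bool * bool))%type.

Definition status (r : bool * bool) w e : etype :=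
  (e \in w, (reached r w (src e), reached r w (tgt e))).

Lemma reached_edge r w e : e \in w -> reached r w (src e) = reached r w (tgt e).
Proof.
move=> /linked_edge st; rewrite /reached; congr (_ && _ || _ && _);
  apply/idP/idP => h; try exact: linked_trans h st;
  by apply: linked_trans h _; rewrite linked_sym.
Qed.

End Connectivity.

Definition alive (t : etype) : bool := t.2.1 || t.2.2.

Lemma in_root_cluster G (w : {set edge G}) e :
  (e \in root_cluster w) = alive (status (true, true) w e).
Proof.
rewrite inE /alive /= /reached /=.
have ls x : linked_set w [set ra G; rb G]%SET x = linked w (ra G) x || linked w (rb G) x.
  apply/existsP/orP => [[y]|[h|h]].
  - by rewrite !inE => /andP[/orP[] /eqP -> ->]; [left|right].
  - by exists (ra G); rewrite !inE eqxx.
  - by exists (rb G); rewrite !inE eqxx orbT.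
rewrite -!ls; apply/existsP/orP => [[y]|[h|h]].
- by rewrite !inE => /andP[/orP[] /eqP -> ->]; [left|right].
- by exists (src e); rewrite !inE eqxx.
- by exists (tgt e); rewrite !inE eqxx orbT.
Qed.

Section Substitution.
Variables G H : ograph.
Hypothesis ra_neq_rb : ra H != rb H.
Implicit Types (W : {set edge (subst_graph G H)}) (e : edge G) (x y : vertex H).

Definition fibres W : {ffun edge G -> {set edge H}} :=
  [ffun e => [set e' | (e, e') \in W]].

Definition coarsen (om : {ffun edge G -> {set edge H}}) : {set edge G} :=
  [set e | linked (om e) (ra H) (rb H)].

Definition unfibre (om : {ffun edge G -> {set edge H}}) :
  {set edge (subst_graph G H)} := [set f | f.2 \in om f.1].

Lemma fibresK : cancel fibres unfibre.
Proof. by move=> W; apply/setP => -[e e']; rewrite !inE /= ffunE inE. Qed.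

Lemma unfibreK : cancel unfibre fibres.
Proof.
by move=> om; apply/ffunP => e; apply/setP => e'; rewrite ffunE !inE.
Qed.

Lemma glue_ra e : glue_vertex e (ra H) = inl (src e).
Proof. by rewrite /glue_vertex insubF ?eqxx. Qed.

Lemma glue_rb e : glue_vertex e (rb H) = inl (tgt e).
Proof.
by rewrite /glue_vertex insubF ?eqxx ?andbF // eq_sym (negbTE ra_neq_rb).
Qed.

Lemma linked_glue W e x y : linked (fibres W e) x y ->
  linked W (glue_vertex e x) (glue_vertex e y).
Proof.
move=> xy; rewrite -(@linked_ind _ (fibres W e)
  (fun z => linked W (glue_vertex e x) (glue_vertex e z)) x y) ?linked_refl //.
move=> e'; rewrite ffunE inE => /linked_edge /= eW.
apply/idP/idP => h; first exact: linked_trans h eW.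
by apply: linked_trans h _; rewrite linked_sym.
Qed.

Lemma linked_inl W (u v : vertex G) : linked (coarsen (fibres W)) u v ->
  linked W (inl u : vertex (subst_graph G H)) (inl v).
Proof.
move=> uv; rewrite -(@linked_ind _ (coarsen (fibres W))
  (fun z => linked W (inl u : vertex (subst_graph G H)) (inl z)) u v) ?linked_refl //.
move=> e; rewrite inE => /linked_glue; rewrite glue_ra glue_rb => eW.
apply/idP/idP => h; first exact: linked_trans h eW.
by apply: linked_trans h _; rewrite linked_sym.
Qed.

(** A path of the substituted graph enters and leaves a copy of [H] through its
    terminals, so that a vertex of the copy replacing [e] is reached exactly
    when it is reached, inside the copy, from a reached endvertex of [e]. *)
Lemma linked_subst W (u : vertex G) e x :
  linked W (inl u : vertex (subst_graph G H)) (glue_vertex e x) =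
  reached (linked (coarsen (fibres W)) u (src e),
           linked (coarsen (fibres W)) u (tgt e)) (fibres W e) x.
Proof.
set C := coarsen _.
pose Q e x := reached (linked C u (src e), linked C u (tgt e)) (fibres W e) x.
have Qa f : Q f (ra H) = linked C u (src f).
  rewrite /Q /reached linked_refl andbT /=.
  apply/orP/idP => [[//|/andP[uf fC]]|]; last by left.
  apply: linked_trans uf _; rewrite linked_sym; apply: linked_edge.
  by rewrite inE linked_sym.
have Qb f : Q f (rb H) = linked C u (tgt f).
  rewrite /Q /reached linked_refl andbT /=.
  apply/orP/idP => [[/andP[uf fC]|//]|]; last by right.
  by apply: linked_trans uf _; apply: linked_edge; rewrite inE.
apply/idP/idP; last first.
  have := @linked_inl W u; rewrite -/C => CW.
  case/orP => /= /andP[/CW h1 /linked_glue]; rewrite ?glue_ra ?glue_rb.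
    exact: linked_trans.
  exact: linked_trans.
pose P (z : vertex (subst_graph G H)) := match z with
  | inl v => linked C u v | inr (f, z) => Q f (val z) end.
have PQ f z : P (glue_vertex f z) = Q f z.
  rewrite {1}/glue_vertex; case: insubP => [v _ /= <- //|].
  rewrite negb_and !negbK => /orP[|] /eqP ->; first by rewrite eqxx /= Qa.
  by rewrite eq_sym (negbTE ra_neq_rb) /= Qb.
have PW : forall f, f \in W -> P (src f) = P (tgt f).
  move=> [f f'] fW; rewrite /= !PQ; apply: reached_edge.
  by rewrite ffunE inE.
move=> /(linked_ind PW); rewrite PQ /Q => <-; exact: linked_refl.
Qed.

Lemma status_subst r W e (e' : edge H) :
  status r W ((e, e') : edge (subst_graph G H)) =
  status (status r (coarsen (fibres W)) e).2 (fibres W e) e'.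
Proof.
rewrite /status ffunE inE; congr (_, (_, _));
  rewrite {1}/reached /= !linked_subst ffunE /reached /=;
  case: r => [[] []] /=; rewrite ?orbF ?andbF //;
  do 4 case: linked => //=; by do ?case: linked.
Qed.

End Substitution.

(** * Independence and the offspring law *)

Section IndependentFamilies.
Variables (R : realType) (I T : finType) (K : I -> T -> R).
Hypothesis K1 : forall i, \sum_t K i t = 1.

Let E (F : {ffun I -> T} -> R) : R :=
  \sum_(om : {ffun I -> T}) (\prod_i K i (om i)) * F om.

Lemma indep_prod (g : I -> T -> R) :
  E (fun om => \prod_i g i (om i)) = \prod_i \sum_t K i t * g i t.
Proof.
rewrite bigA_distr_bigA; apply: eq_bigr => om _.
by rewrite big_split.
Qed.

Lemma indep_cst (c : R) : E (fun=> c) = c.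
Proof.
rewrite /E -mulr_suml -bigA_distr_bigA big1 ?mul1r // => i _; exact: K1.
Qed.

Lemma indep_sum (F : I -> T -> R) :
  E (fun om => \sum_i F i (om i)) = \sum_i \sum_t K i t * F i t.
Proof.
rewrite /E; under eq_bigr do rewrite mulr_sumr.
rewrite exchange_big /=; apply: eq_bigr => i _.
transitivity (E (fun om => \prod_j (if j == i then F j (om j) else 1))).
  by apply: eq_bigr => om _; rewrite -big_mkcond big_pred1_eq.
rewrite (indep_prod (fun j t => if j == i then F j t else 1)) (bigD1 i) //= eqxx.
rewrite [X in _ * X]big1 ?mulr1 // => j /negbTE ->.
by under eq_bigr do rewrite mulr1; exact: K1.
Qed.

Lemma indep_pair (F : I -> T -> R) i j : i != j ->
  E (fun om => F i (om i) * F j (om j)) =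
  (\sum_t K i t * F i t) * (\sum_t K j t * F j t).
Proof.
move=> ij.
transitivity (E (fun om => \prod_k (if (k == i) || (k == j) then F k (om k) else 1))).
  apply: eq_bigr => om _; congr (_ * _).
  rewrite (bigD1 i) //= eqxx (bigD1 j) 1?eq_sym //= eqxx orbT.
  rewrite big1 ?mulr1 // => k /andP[/negbTE -> /negbTE ->] //.
rewrite (indep_prod (fun k t => if (k == i) || (k == j) then F k t else 1)).
rewrite (bigD1 i) //= eqxx (bigD1 j) 1?eq_sym //= eqxx orbT.
rewrite [X in _ * (_ * X)]big1 ?mulr1 // => k /andP[/negbTE -> /negbTE ->] /=.
by under eq_bigr do rewrite mulr1; exact: K1.
Qed.

(** Variances of independent summands add up, and each is at most the second
    moment. *)
Lemma indep_square (F : I -> T -> R) (c : R) :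
  E (fun om => (\sum_i F i (om i) + c) ^+ 2) <=
  (\sum_i \sum_t K i t * F i t + c) ^+ 2 + \sum_i \sum_t K i t * F i t ^+ 2.
Proof.
pose m i := \sum_t K i t * F i t.
have sq (f : I -> R) : (\sum_i f i + c) ^+ 2 =
    \sum_i f i ^+ 2 + \sum_i \sum_(j | j != i) f i * f j
    + (\sum_i f i * (2 * c) + c ^+ 2).
  rewrite sqrrD; have -> : (\sum_i f i) ^+ 2 =
      \sum_i f i ^+ 2 + \sum_i \sum_(j | j != i) f i * f j.
    rewrite expr2 big_distrl -big_split /=; apply: eq_bigr => i _.
    by rewrite big_distrr (bigD1 i) //= expr2.
  by rewrite -!addrA; congr (_ + (_ + _)); rewrite -mulr_suml; ring.
rewrite {1}/E; under eq_bigr do rewrite sq 2!mulrDr mulrDr.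
rewrite !big_split /= -/(E _) -/(E _) -/(E _) -/(E _) indep_cst.
rewrite (indep_sum (fun i t => F i t ^+ 2)).
rewrite (indep_sum (fun i t => F i t * (2 * c))).
have -> : E (fun om => \sum_i \sum_(j | j != i) F i (om i) * F j (om j)) =
    \sum_i \sum_(j | j != i) m i * m j.
  rewrite /E; under eq_bigr do rewrite mulr_sumr.
  rewrite exchange_big /=; apply: eq_bigr => i _.
  under eq_bigr do rewrite mulr_sumr.
  rewrite exchange_big /=; apply: eq_bigr => j ij.
  by apply: indep_pair; rewrite eq_sym.
rewrite (sq m).
have -> : \sum_i \sum_t K i t * (F i t * (2 * c)) = \sum_i m i * (2 * c).
  apply: eq_bigr => i _; rewrite /m mulr_suml.
  by apply: eq_bigr => t _; rewrite mulrA.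
have : 0 <= \sum_i m i ^+ 2 by apply: sumr_ge0 => i _; exact: sqr_ge0.
lra.
Qed.

End IndependentFamilies.

Section Offspring.
Variables (R : realType) (p : R).
Hypothesis p01 : 0 < p < 1.

Definition bern (o : bool) : R := if o then p else 1 - p.

Lemma bern_gt0 o : 0 < bern o.
Proof. by case/andP: p01 => p0 p1; case: o; rewrite /bern // subr_gt0. Qed.

Lemma perc_weight_gt0 G (w : {set edge G}) : 0 < perc_weight p w.
Proof. by apply: prodr_gt0 => e _; exact: (bern_gt0 (e \in w)). Qed.

Lemma sum_perc_weight G : \sum_(w : {set edge G}) perc_weight p w = 1.
Proof.
transitivity (\prod_(e : edge G) (p + (1 - p))).
  by rewrite bigA_distr; apply: eq_bigl.
by rewrite big1 // => e _; rewrite addrC subrK.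
Qed.

Lemma perc_expect_cst G (c : R) : perc_expect (G := G) p (fun=> c) = c.
Proof. by rewrite /perc_expect -mulr_suml sum_perc_weight mul1r. Qed.

Lemma ler_perc_expect G (X Y : {set edge G} -> R) : (forall w, X w <= Y w) ->
  perc_expect p X <= perc_expect p Y.
Proof. by move=> XY; apply: ler_sum => w _; rewrite ler_pM2l ?perc_weight_gt0. Qed.

Lemma perc_expectD G (X Y : {set edge G} -> R) :
  perc_expect p (fun w => X w + Y w) = perc_expect p X + perc_expect p Y.
Proof. by rewrite /perc_expect -big_split; apply: eq_bigr => w _; rewrite mulrDr. Qed.

Lemma perc_expectZ G (c : R) (X : {set edge G} -> R) :
  perc_expect p (fun w => c * X w) = c * perc_expect p X.
Proof. by rewrite /perc_expect mulr_sumr; apply: eq_bigr => w _; rewrite mulrCA. Qed.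

(** Sum over all edges of a weight attached to types; a weight vanishing on
    unreached types sums over the cluster only. *)
Definition type_sum G (x : etype -> R) r (w : {set edge G}) : R :=
  \sum_e x (status r w e).

Variable G1 : ograph.
Hypothesis ra_neq_rb : ra G1 != rb G1.
Hypothesis p_fixed : cross_prob G1 p = p.

(** Percolation on [G1] conditioned to be crossed, or not to be crossed,
    according to the state [o] of the edge that the copy of [G1] replaces. *)
Definition cond_weight (o : bool) (u : {set edge G1}) : R :=
  if linked u (ra G1) (rb G1) == o then perc_weight p u / bern o else 0.

Lemma cond_weight_ge0 o u : 0 <= cond_weight o u.
Proof.
rewrite /cond_weight; case: ifP => // _.
by apply: ltW; rewrite divr_gt0 ?perc_weight_gt0 ?bern_gt0.
Qed.

Lemma sum_cond_weight o : \sum_u cond_weight o u = 1.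
Proof.
rewrite -big_mkcond -mulr_suml /=.
have {1}-> : \sum_(u : {set edge G1} | linked u (ra G1) (rb G1) == o)
    perc_weight p u = bern o; last by rewrite divff // gt_eqF ?bern_gt0.
have pT : \sum_(u : {set edge G1} | linked u (ra G1) (rb G1)) perc_weight p u = p.
  by rewrite -[RHS]p_fixed /cross_prob /perc_prob.
case: o => /=; first by rewrite -[RHS]pT; apply: eq_bigl => u; rewrite eqb_id.
rewrite /bern -(sum_perc_weight G1).
rewrite [in RHS](bigID (fun u => linked u (ra G1) (rb G1))) /= pT.
by rewrite addrC addrK; apply: eq_bigl => u; rewrite eqbF_neg.
Qed.

(** Since [p] is a fixed point of the crossing probability, the crossed copies
    of [G1] form a percolation of parameter [p] on [G]; given it, the copies
    are independent with laws [cond_weight]. *)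
Lemma perc_expect_subst G
    (Phi : {set edge G} -> {ffun edge G -> {set edge G1}} -> R) :
  perc_expect (G := subst_graph G G1) p
    (fun W => Phi (coarsen (fibres W)) (fibres W)) =
  perc_expect p (fun w =>
    \sum_(om : {ffun edge G -> {set edge G1}})
      (\prod_e cond_weight (e \in w) (om e)) * Phi w om).
Proof.
have unfibre_bij : bijective (@unfibre G G1).
  by exists (@fibres G G1); [exact: unfibreK | exact: fibresK].
rewrite /perc_expect (reindex (@unfibre G G1)) /=; last exact: onW_bij.
under [RHS]eq_bigr do rewrite mulr_sumr.
rewrite [RHS]exchange_big /=; apply: eq_bigr => om _.
rewrite unfibreK (bigD1 (coarsen om)) //= mulrA [X in _ = _ + X]big1 ?addr0.
  congr (_ * _); rewrite /perc_weight.
  rewrite (eq_bigr (fun e : edge G * edge G1 => bern (e.2 \in om e.1))); last first.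
    by move=> e _; rewrite inE.
  rewrite -(pair_bigA _ (fun e e' => bern (e' \in om e))) /= -big_split /=.
  apply: eq_bigr => e _; rewrite /cond_weight inE eqxx mulrC -/(bern _).
  by rewrite mulfVK // gt_eqF // bern_gt0.
move=> w wom.
have [e ewom] : exists e, (e \in w) != (e \in coarsen om).
  apply/existsP; apply: contraNT wom => /existsPn h; apply/eqP/setP => e.
  by apply/eqP; have := h e; rewrite negbK.
rewrite (bigD1 e) //= /cond_weight ifF ?mul0r ?mulr0 //.
by apply: negbTE; move: ewom; rewrite inE eq_sym.
Qed.

Lemma perc_expect_coarsen G (X : {set edge G} -> R) :
  perc_expect (G := subst_graph G G1) p (fun W => X (coarsen (fibres W))) =
  perc_expect p X.
Proof.
rewrite (perc_expect_subst (fun w _ => X w)); apply: eq_bigr => w _.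
by rewrite (indep_cst (fun e => sum_cond_weight (e \in w))).
Qed.

Definition offspring_mean (x : etype -> R) (t : etype) : R :=
  \sum_u cond_weight t.1 u * type_sum x t.2 u.

Definition offspring_square (x : etype -> R) (t : etype) : R :=
  \sum_u cond_weight t.1 u * type_sum x t.2 u ^+ 2.

Definition genfun (s : etype -> R) (t : etype) : R :=
  \sum_u cond_weight t.1 u * \prod_e s (status t.2 u e).

Lemma type_sum_subst G (x : etype -> R) r (W : {set edge (subst_graph G G1)}) :
  type_sum x r W =
  \sum_e type_sum x (status r (coarsen (fibres W)) e).2 (fibres W e).
Proof.
rewrite /type_sum pair_bigA /=; apply: eq_bigr => -[e e'] _.
by rewrite status_subst.
Qed.

Lemma expect_type_sum_subst G x r :
  perc_expect (G := subst_graph G G1) p (type_sum x r) =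
  perc_expect (G := G) p (type_sum (offspring_mean x) r).
Proof.
under [LHS]eq_bigr do rewrite type_sum_subst.
rewrite -/(perc_expect p _) (perc_expect_subst (fun w om =>
  \sum_e type_sum x (status r w e).2 (om e))).
apply: eq_bigr => w _; congr (_ * _).
by rewrite (indep_sum (fun e => sum_cond_weight (e \in w))
  (fun e u => type_sum x (status r w e).2 u)).
Qed.

Lemma expect_square_subst G x z r :
  perc_expect p (fun W : {set edge (subst_graph G G1)} =>
    (type_sum x r W + type_sum z r (coarsen (fibres W))) ^+ 2) <=
  perc_expect (G := G) p (fun w =>
    type_sum (fun t => offspring_mean x t + z t) r w ^+ 2) +
  perc_expect (G := G) p (type_sum (offspring_square x) r).
Proof.
under [leLHS]eq_bigr do rewrite type_sum_subst.
rewrite -/(perc_expect p _) (perc_expect_subst (fun w om =>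
  (\sum_e type_sum x (status r w e).2 (om e) + type_sum z r w) ^+ 2)).
rewrite -perc_expectD; apply: ler_perc_expect => w.
apply: le_trans (indep_square (fun e => sum_cond_weight (e \in w))
  (fun e u => type_sum x (status r w e).2 u) (type_sum z r w)) _.
by rewrite [type_sum (fun t => _ + _) _ _]/type_sum big_split.
Qed.

Lemma expect_prod_subst G s r :
  perc_expect p (fun W : {set edge (subst_graph G G1)} =>
    \prod_e s (status r W e)) =
  perc_expect (G := G) p (fun w => \prod_e genfun s (status r w e)).
Proof.
under [LHS]eq_bigr => W _.
  rewrite (eq_bigr (fun ee : edge G * edge G1 =>
    s (status (status r (coarsen (fibres W)) ee.1).2 (fibres W ee.1) ee.2))); last first.
    by move=> [e e'] _; rewrite status_subst.
  rewrite -(pair_bigA _ (fun e e' =>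
    s (status (status r (coarsen (fibres W)) e).2 (fibres W e) e'))) /=.
over.
rewrite -/(perc_expect p _) (perc_expect_subst (fun w om =>
  \prod_e \prod_e' s (status (status r w e).2 (om e) e'))).
apply: eq_bigr => w _; congr (_ * _).
exact: (indep_prod _ (fun e u => \prod_e' s (status (status r w e).2 u e'))).
Qed.

End Offspring.

(** * Configurations of the generating graph *)

Section Configurations.
Variable G : ograph.
Implicit Types (x y : vertex G) (e : edge G) (w : {set edge G}).

Lemma path_linked x s : path (adj [set: edge G]%SET) x s ->
  linked (path_edges x s) x (last x s).
Proof.
elim: s x => [|z s IH] x /=; first by rewrite linked_refl.
case/andP => /existsP[e /andP[_ exz]] /IH zs.
have ez : ends e = [set x; z]%SET.
  by case/orP: exz => /andP[/eqP <- /eqP <-] //; rewrite /ends finset.setUC.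
have ep : e \in path_edges x (z :: s) by rewrite inE /= inE ez eqxx.
apply: (@linked_trans _ _ z).
  apply: connect1; apply/existsP; exists e; rewrite ep; exact: exz.
apply: linkedS zs; apply/fintype.subsetP => f; rewrite !inE => ->.
by rewrite orbT.
Qed.

(** Otherwise the property of being equal to [x] would be invariant along [w]. *)
Lemma incident_edge w x y : x != y -> linked w x y ->
  exists2 e, e \in w & (x == src e) (+) (x == tgt e).
Proof.
move=> xy /(linked_ind (P := pred1 x)) h.
have [/existsP[e /andP[ew ex]]|/existsPn noe] :=
    boolP [exists e, (e \in w) && ((x == src e) (+) (x == tgt e))].
  by exists e.
move: xy; rewrite eq_sym; have /= := h; rewrite eqxx eq_sym => <- // e ew.
by have := noe e; rewrite ew /= negb_add ![x == _]eq_sym => /eqP.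
Qed.

Hypothesis G_dist : (1 < gdist (ra G) (rb G))%N.

Let far n : (n < 2)%N -> [exists s : n.-tuple (vertex G),
  path (adj [set: edge G]%SET) (ra G) s && (last (ra G) s == rb G)] = false.
Proof.
move=> n2; have nd := leq_trans n2 G_dist.
move: (nd); rewrite /gdist => /(before_find 0%N); rewrite nth_iota ?add0n //.
have := find_size (fun n => [exists s : n.-tuple (vertex G),
  path (adj [set: edge G]%SET) (ra G) s && (last (ra G) s == rb G)])
  (iota 0 #|vertex G|).
by rewrite size_iota; exact: leq_trans.
Qed.

Lemma dist_gt1_neq : ra G != rb G.
Proof.
apply/negP => ab; have /existsP[] := far (isT : (0 < 2)%N).
by exists [tuple].
Qed.

Lemma dist_gt1_nonadjacent w : ~~ adj w (ra G) (rb G).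
Proof.
apply/negP => ab; have /existsP[] := far (isT : (1 < 2)%N).
exists [tuple (rb G)]; rewrite /= eqxx !andbT.
move: ab => /existsP[e /andP[_ h]]; apply/existsP; exists e.
by rewrite inE.
Qed.

Lemma single_edge_not_crossing e : ~~ linked [set e]%SET (ra G) (rb G).
Proof.
apply/negP => ab.
have ba : linked [set e]%SET (rb G) (ra G) by rewrite linked_sym.
have [f] := incident_edge dist_gt1_neq ab; rewrite inE => /eqP -> fa.
have b_neq_a : rb G != ra G by rewrite eq_sym dist_gt1_neq.
have [g] := incident_edge b_neq_a ba; rewrite inE => /eqP -> gb.
have /negP[] := dist_gt1_nonadjacent [set e]%SET.
apply/existsP; exists e; rewrite inE eqxx /=.
have apart z : ~~ ((ra G == z) && (rb G == z)).
  by apply/negP => /andP[/eqP <-]; rewrite (negbTE b_neq_a).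
move: fa gb (apart (src e)) (apart (tgt e)).
rewrite ![src e == _]eq_sym ![tgt e == _]eq_sym.
by case: (ra G == src e); case: (ra G == tgt e); case: (rb G == src e);
  case: (rb G == tgt e).
Qed.

Hypothesis G_paths : two_edge_disjoint_paths (ra G) (rb G).

Lemma disjoint_crossings : exists w1 w2,
  [/\ linked w1 (ra G) (rb G), linked w2 (ra G) (rb G)
    & w1 :&: w2 = finset.set0].
Proof.
case: G_paths => s1 [s2 [/and3P[p1 /eqP l1 _] /and3P[p2 /eqP l2 _] dis]].
exists (path_edges (ra G) s1), (path_edges (ra G) s2); split => //.
  by have := path_linked p1; rewrite l1.
by have := path_linked p2; rewrite l2.
Qed.

Lemma degree_ge2 x y : x != y ->
  (x, y) = (ra G, rb G) \/ (x, y) = (rb G, ra G) ->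
  exists e1 e2, [/\ e1 != e2, (x == src e1) || (x == tgt e1)
    & (x == src e2) || (x == tgt e2)].
Proof.
move=> xy h; have [w1 [w2 [l1 l2 dis]]] := disjoint_crossings.
have {}l1 : linked w1 x y by case: h => -[-> ->] //; rewrite linked_sym.
have {}l2 : linked w2 x y by case: h => -[-> ->] //; rewrite linked_sym.
have [e1 e1w xe1] := incident_edge xy l1.
have [e2 e2w xe2] := incident_edge xy l2.
exists e1, e2; split; first 1 last.
- by move: xe1; case: eqP; case: eqP.
- by move: xe2; case: eqP; case: eqP.
apply/eqP => e12; have /setP/(_ e1) := dis.
by rewrite !inE e1w e12 e2w.
Qed.

(** An edge of a minimal crossing set has both endvertices joined to a
    terminal by the other edges of that set; a second, disjoint crossing keeps
    the terminals connected when this edge is closed. *)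
Lemma closed_edge_in_crossing : exists e,
  let w := [set~ e]%SET in
  [/\ linked w (ra G) (rb G), linked w (ra G) (src e)
    & linked w (ra G) (tgt e)].
Proof.
have [w1 [w2 [l1 l2 dis]]] := disjoint_crossings.
pose crossing w := linked w (ra G) (rb G).
have [w /finset.minsetP[lw minw] ww1] := finset.minset_exists (P := crossing) l1.
have [e ew ea] := incident_edge dist_gt1_neq lw.
exists e => w'.
have ww' : w :\ e \subset w'.
  by apply/fintype.subsetP => f; rewrite !inE => /andP[].
have w2w' : w2 \subset w'.
  apply/fintype.subsetP => f fw2; rewrite !inE; apply/eqP => fe.
  have /setP/(_ e) := dis.
  by rewrite !inE (fintype.subsetP ww1 _ ew) -fe fw2.
have ab : linked w' (ra G) (rb G) by exact: linkedS l2.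
have pivotal : ~~ linked (w :\ e) (ra G) (rb G).
  apply/negP => /minw /(_ (finset.subD1set _ _))/setP/(_ e).
  by rewrite !inE eqxx ew.
pose Q z := linked (w :\ e) (src e) z || linked (w :\ e) (tgt e) z.
have QQ : Q (ra G) = Q (rb G).
  apply: (linked_ind _ lw) => f fw; have [->|fe] := eqVneq f e.
    by rewrite /Q !linked_refl orbT.
  have /linked_edge fw' : f \in w :\ e by rewrite !inE fe.
  congr (_ || _); apply/idP/idP => h; try exact: linked_trans h fw';
  by apply: linked_trans h _; rewrite linked_sym.
have Qb : Q (rb G).
  rewrite -QQ /Q; move: ea; case: (eqVneq (ra G) (src e)) => [<-|_ /=].
    by rewrite linked_refl.
  by move=> /eqP <-; rewrite linked_refl orbT.
have toa z : linked (w :\ e) z (rb G) -> linked w' (ra G) z.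
  by move=> /(linkedS ww') h; apply: linked_trans ab _; rewrite linked_sym.
move: Qb; rewrite /Q; move: ea pivotal => /=.
case: eqVneq => [<-|_ /=] /=.
  by move=> _ /negbTE -> /=; split=> //; [exact: linked_refl|exact: toa].
move=> /eqP <- /negbTE ->; rewrite orbF; split=> //; last exact: linked_refl.
exact: toa.
Qed.

End Configurations.

(** * Positive operators with a Harnack inequality *)

Lemma sum_geometric_le (R : realFieldType) (g : R) n : 0 <= g < 1 ->
  \sum_(i < n) g ^+ i <= (1 - g)^-1.
Proof.
move=> /andP[g0 g1]; have g'0 : 0 < 1 - g by rewrite subr_gt0.
rewrite -(ler_pM2l g'0) mulfV ?gt_eqF //.
elim: n => [|n IH]; first by rewrite big_ord0 mulr0.
have -> : (1 - g) * \sum_(i < n.+1) g ^+ i = 1 - g ^+ n.+1.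
  have := subrX1 g n.+1; rewrite -[X in _ * X](eq_bigr _ (fun i _ => erefl)).
  by move=> /(congr1 -%R); rewrite opprB => ->; rewrite -mulNr opprB.
by rewrite gerBl exprn_ge0.
Qed.

(** A growth factor $1 + a g^k$ is harmless, since $\sum_k a g^k$ is finite. *)
Lemma perturbed_bound (R : realType) (a g : R) (u : nat -> R) :
  0 <= a -> 0 <= g < 1 -> (forall k, 0 <= u k) ->
  (forall k, u k.+1 <= (1 + a * g ^+ k) * u k) ->
  forall k, u k <= expR (a / (1 - g)) * u 0%N.
Proof.
move=> a0 g01 u0 ustep k; have /andP[g0 _] := g01.
apply: (@le_trans _ _ (expR (a * \sum_(i < k) g ^+ i) * u 0%N)); last first.
  by rewrite ler_wpM2r // ler_expR ler_wpM2l // sum_geometric_le.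
elim: k => [|k IH]; first by rewrite big_ord0 mulr0 expR0 mul1r.
apply: le_trans (ustep k) _; rewrite big_ord_recr /= mulrDr expRD.
rewrite [X in _ <= X * _]mulrC -mulrA; apply: ler_pM => //.
  by rewrite addr_ge0 // mulr_ge0 // exprn_ge0.
exact: expR_ge1Dx.
Qed.

Section RatioLimit.
Variables (R : realType) (T : Type) (N : (T -> R) -> T -> R) (y0 : T -> R).
Variables (o : T) (D delta : R).
Let y k := iter k N y0.

Hypothesis N_linear : forall a b x z t,
  N (fun t => a * x t + b * z t) t = a * N x t + b * N z t.
Hypothesis N_ge0 : forall x, (forall t, 0 <= x t) -> forall t, 0 <= N x t.
Hypothesis y0_ge0 : forall t, 0 <= y0 t.
Hypothesis y0_lo : forall t, 2 * y0 t <= N y0 t.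
Hypothesis y0_hi : forall t, N y0 t <= D * y0 t.
Hypothesis y0_o : 0 < y0 o.
Hypothesis delta01 : 0 < delta < 1.
Hypothesis harnack : forall k x, (forall t, 0 <= x t) -> forall t,
  delta * y k.+2 t * x o <= y k.+1 o * N x t.

Lemma iter_ge0 k t : 0 <= y k t.
Proof. by elim: k t => [|k IH] t //=; exact: N_ge0. Qed.

Lemma positive_operator_lower a x z : (forall t, a * x t <= z t) ->
  forall t, a * N x t <= N z t.
Proof.
move=> axz t; rewrite -subr_ge0 -[N z t]mul1r -mulNr -N_linear.
by apply: N_ge0 => s; rewrite mul1r mulNr subr_ge0.
Qed.

Lemma positive_operator_upper a x z : (forall t, z t <= a * x t) ->
  forall t, N z t <= a * N x t.
Proof.
move=> axz t; rewrite -subr_ge0 -[N z t]mul1r -mulNr -N_linear.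
by apply: N_ge0 => s; rewrite mulNr mul1r subr_ge0.
Qed.

Lemma iter_lo k t : 2 * y k t <= y k.+1 t.
Proof. by elim: k t => [|k IH] t; [exact: y0_lo | exact: positive_operator_lower]. Qed.

Lemma iter_hi k t : y k.+1 t <= D * y k t.
Proof. by elim: k t => [|k IH] t; [exact: y0_hi | exact: positive_operator_upper]. Qed.

Lemma iter_o_gt0 k : 0 < y k o.
Proof.
elim: k => [//|k IH]; apply: lt_le_trans (iter_lo k o).
by rewrite mulr_gt0.
Qed.

(** Both bounds on the ratio [y k.+2 / y k.+1] move towards its value at [o] by
    the proportion [delta]. *)
Fixpoint ratio_bounds k : R * R :=
  if k is k'.+1 then
    let: (lo, hi) := ratio_bounds k' in
    let r := y k'.+2 o / y k'.+1 o in
    (lo + delta * (r - lo), hi - delta * (hi - r))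
  else (2, D).

Let lo k := (ratio_bounds k).1.
Let hi k := (ratio_bounds k).2.

Lemma ratio_boundsP k t :
  lo k * y k.+1 t <= y k.+2 t <= hi k * y k.+1 t.
Proof.
rewrite /lo /hi; elim: k t => [|k IH] t.
  by apply/andP; split; [exact: iter_lo | exact: iter_hi].
rewrite [ratio_bounds _]/=.
case: ratio_bounds IH => l h; rewrite [(l, h).1]/= [(l, h).2]/= => IH.
set r := _ / _; rewrite [X in X * _ <= _]/= [X in _ <= X * _]/=.
have y1 := iter_o_gt0 k.+1.
have ry : r * y k.+1 o = y k.+2 o by rewrite divfK // gt_eqF.
have x1_ge0 s : 0 <= 1 * y k.+2 s + - l * y k.+1 s.
  by have /andP[+ _] := IH s; lra.
have x2_ge0 s : 0 <= h * y k.+1 s + -1 * y k.+2 s.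
  by have /andP[_] := IH s; lra.
have H1 := harnack k x1_ge0 t; have H2 := harnack k x2_ge0 t.
rewrite N_linear -ry -[N _]/(y k.+3) -[N (y k.+1)]/(y k.+2) in H1.
rewrite N_linear -ry -[N (y k.+2)]/(y k.+3) -[N _]/(y k.+2) in H2.
apply/andP; split; rewrite -subr_ge0 -(pmulr_rge0 _ y1); lra.
Qed.

Lemma ratio_bounds_step k :
  [/\ lo k <= lo k.+1, hi k.+1 <= hi k &
      hi k.+1 - lo k.+1 = (1 - delta) * (hi k - lo k)].
Proof.
have := ratio_boundsP k o; rewrite /lo /hi [ratio_bounds k.+1]/=.
case: ratio_bounds => l h; rewrite [(l, h).1]/= [(l, h).2]/=.
set r := _ / _; rewrite [(_, _).1]/= [(_, _).2]/=.
have y1 := iter_o_gt0 k.+1.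
rewrite -ler_pdivlMr // -[X in _ && X]ler_pdivrMr // -/r => /andP[lr rh].
have /andP[d0 d1] := delta01; split; last ring.
- by rewrite lerDl mulr_ge0 ?subr_ge0 // ltW.
- by rewrite gerBl mulr_ge0 ?subr_ge0 // ltW.
Qed.

Lemma ratio_gap k : hi k - lo k = (1 - delta) ^+ k * (D - 2).
Proof.
elim: k => [|k IH]; first by rewrite mul1r.
by have [_ _ ->] := ratio_bounds_step k; rewrite IH exprS mulrA.
Qed.

Lemma D_ge2 : 2 <= D.
Proof. by rewrite -(ler_pM2r y0_o); exact: le_trans (y0_lo o) (y0_hi o). Qed.

Lemma lo_le_hi i j : lo i <= hi j.
Proof.
have /andP[d0 d1] := delta01.
have lom : {homo lo : m n / (m <= n)%N >-> m <= n}.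
  apply: homo_leq => [x|x z w|n]; [exact: lexx | exact: le_trans |].
  by have [] := ratio_bounds_step n.
have him : {homo hi : m n / (m <= n)%N >-> n <= m}.
  apply: homo_leq => [x|x z w h1 h2|n]; [exact: lexx | exact: le_trans h2 h1 |].
  by have [] := ratio_bounds_step n.
apply: le_trans (lom _ _ (leq_maxl i j)) (le_trans _ (him _ _ (leq_maxr i j))).
rewrite -subr_ge0 ratio_gap mulr_ge0 //; last by rewrite subr_ge0 D_ge2.
by rewrite exprn_ge0 // subr_ge0 ltW.
Qed.

(** Iterates of a positive operator grow at a geometric rate as soon as they
    satisfy a Harnack inequality: by [harnack], the value of the ratio at the
    single point [o] influences all later ratios by a fixed proportion, so the
    oscillation of the ratio shrinks geometrically. *)
Lemma ratio_limit : exists rho C g, [/\ 2 <= rho, 0 < g < 1, 0 <= C &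
  forall k t, `|y k.+1 t - rho * y k t| <= C * g ^+ k * y k t].
Proof.
have /andP[d0 d1] := delta01.
pose rho := reals.sup (range lo).
have lo_rho k : lo k <= rho.
  apply: ub_le_sup; last by exists k.
  by exists (hi 0%N) => _ [i _ <-]; exact: lo_le_hi.
have rho_hi k : rho <= hi k.
  apply: ge_sup; first by exists (lo 0%N), 0%N.
  by move=> _ [i _ <-]; exact: lo_le_hi.
have rho2 : 2 <= rho by exact: lo_rho 0%N.
pose g := 1 - delta.
have g0 : 0 < g by rewrite subr_gt0.
exists rho, (D + rho + (D - 2) / g), g; split => //.
- by rewrite g0 /g gtrBl.
- have D2 := D_ge2; have : 0 <= (D - 2) / g.
    by rewrite divr_ge0 ?(ltW g0) // subr_ge0.
  lra.
case=> [|k] t.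
  rewrite expr0 mulr1; apply: le_trans (ler_normB _ _) _.
  rewrite ger0_norm ?iter_ge0 // normrM (ger0_norm (y0_ge0 t)).
  rewrite ger0_norm; last lra.
  apply: (@le_trans _ _ ((D + rho) * y0 t)).
    by have := y0_hi t; rewrite -[N y0 t]/(y 1 t); lra.
  rewrite ler_wpM2r // lerDl divr_ge0 ?(ltW g0) //.
  by rewrite subr_ge0; exact: D_ge2.
have h : (D - 2) * g ^+ k * y k.+1 t <=
         (D + rho + (D - 2) / g) * g ^+ k.+1 * y k.+1 t.
  rewrite ler_wpM2r ?iter_ge0 // exprS mulrA ler_wpM2r ?exprn_ge0 ?(ltW g0) //.
  rewrite mulrDl divfK ?gt_eqF // lerDr mulr_ge0 ?(ltW g0) //.
  by have := D_ge2; lra.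
apply: le_trans h.
have yk := iter_ge0 k.+1 t; have /andP[b1 b2] := ratio_boundsP k t.
have gap := ratio_gap k; rewrite -/g in gap.
have := ler_wpM2r yk (lo_rho k); have := ler_wpM2r yk (rho_hi k).
rewrite [(D - 2) * _]mulrC -gap mulrBl ler_norml => c1 c2.
by apply/andP; split; lra.
Qed.

End RatioLimit.

(** Geometrically small relative errors in $u_{k+1} = \rho u_k$ only cost a
    bounded factor: [perturbed_bound] applies to $u_k/\rho^k$ and, for the lower
    bound, to its inverse. *)
Lemma geometric_growth (R : realType) (rho C g : R) : 2 <= rho -> 0 < g < 1 ->
  0 <= C -> exists c C', [/\ 0 < c, 0 < C' & forall u : nat -> R,
  (forall k, 0 <= u k) -> (forall k, 2 * u k <= u k.+1) ->
  (forall k, `|u k.+1 - rho * u k| <= C * g ^+ k * u k) ->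
  forall k, c * rho ^+ k * u 0%N <= u k <= C' * rho ^+ k * u 0%N].
Proof.
move=> rho2 /andP[g0 g1] C0.
have rho0 : 0 < rho by lra.
have g01 : 0 <= g < 1 by rewrite ltW.
exists (expR (C / 2 / (1 - g)))^-1, (expR (C / rho / (1 - g))).
split=> [||u u0 u2 uC k]; rewrite ?invr_gt0 ?expR_gt0 //.
have rk j : 0 < rho ^+ j by rewrite exprn_gt0.
apply/andP; split; last first.
  rewrite -mulrA [_ * u _]mulrC mulrA -ler_pdivrMr //.
  have := @perturbed_bound R (C / rho) g (fun k => u k / rho ^+ k).
  rewrite expr0 divr1; apply => // [||j].
  - by rewrite divr_ge0 // ltW.
  - by move=> j; rewrite divr_ge0 // ltW.
  rewrite ler_pdivrMr // exprS.
  have -> : (1 + C / rho * g ^+ j) * (u j / rho ^+ j) * (rho * rho ^+ j) =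
      rho * u j + C * g ^+ j * u j.
    by field; rewrite ?expf_neq0 ?gt_eqF.
  by have := uC j; rewrite ler_norml => /andP[_]; lra.
have [u00|u00] := eqVneq (u 0%N) 0; first by rewrite u00 mulr0.
have upos j : 0 < u j.
  elim: j => [|j IH]; first by rewrite lt_neqAle eq_sym u00 u0.
  by apply: lt_le_trans (u2 j); rewrite mulr_gt0.
rewrite -mulrA mulrC ler_pdivrMr ?expR_gt0 //.
have := @perturbed_bound R (C / 2) g (fun k => rho ^+ k / u k).
rewrite expr0 div1r => h.
have {}h : rho ^+ k / u k <= expR (C / 2 / (1 - g)) / u 0%N.
  apply: h => // [||j].
  - by rewrite divr_ge0.
  - by move=> j; rewrite divr_ge0 // ltW.
  rewrite ler_pdivrMr // exprS.
  have -> : (1 + C / 2 * g ^+ j) * (rho ^+ j / u j) * u j.+1 =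
      rho ^+ j * ((1 + C / 2 * g ^+ j) * u j.+1 / u j) by ring.
  rewrite mulrC ler_pM2l // ler_pdivlMr // mulrDl mul1r.
  have := uC j; rewrite ler_norml => /andP[+ _].
  have : C * g ^+ j * (2 * u j) <= C * g ^+ j * u j.+1.
    by rewrite ler_wpM2l // mulr_ge0 // exprn_ge0 // ltW.
  lra.
by move: h; rewrite ler_pdivrMr // mulrAC ler_pdivlMr // [_ * u k]mulrC.
Qed.

(** * Growth of the mean offspring *)

Definition alive_indicator (R : realType) (t : etype) : R := (alive t)%:R.
Arguments alive_indicator {R} t.

Section Growth.
Variables (R : realType) (p : R) (G1 : ograph).
Hypothesis p01 : 0 < p < 1.
Hypothesis G1_connected : connected_graph G1.
Hypothesis G1_dist : (1 < gdist (ra G1) (rb G1))%N.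
Hypothesis G1_paths : two_edge_disjoint_paths (ra G1) (rb G1).
Hypothesis p_fixed : cross_prob G1 p = p.

Let N := offspring_mean p G1.
Let D : R := #|edge G1|%:R.

Lemma type_sum_linear G (a b : R) x z r (w : {set edge G}) :
  type_sum (fun t => a * x t + b * z t) r w = a * type_sum x r w + b * type_sum z r w.
Proof. by rewrite /type_sum big_split !mulr_sumr. Qed.

Lemma mean_linear (a b : R) x z t :
  N (fun t => a * x t + b * z t) t = a * N x t + b * N z t.
Proof.
rewrite /N /offspring_mean !mulr_sumr -big_split; apply: eq_bigr => u _.
by rewrite type_sum_linear /=; ring.
Qed.

Lemma mean_ge0 x : (forall t, 0 <= x t) -> forall t, 0 <= N x t.
Proof.
move=> x0 t; apply: sumr_ge0 => u _; rewrite mulr_ge0 ?cond_weight_ge0 //.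
by apply: sumr_ge0.
Qed.

Lemma mean_le x t m : (forall u : {set edge G1}, type_sum x t.2 u <= m) -> N x t <= m.
Proof.
move=> h; rewrite -[leRHS]mul1r -(sum_cond_weight p01 p_fixed t.1) mulr_suml.
by apply: ler_sum => u _; rewrite ler_wpM2l ?cond_weight_ge0.
Qed.

Lemma mean_ge x t m : (forall u : {set edge G1}, m <= type_sum x t.2 u) -> m <= N x t.
Proof.
move=> h; rewrite -[leLHS]mul1r -(sum_cond_weight p01 p_fixed t.1) mulr_suml.
by apply: ler_sum => u _; rewrite ler_wpM2l ?cond_weight_ge0.
Qed.

Lemma alive_status r (u : {set edge G1}) e :
  alive (status r u e) -> r.1 || r.2.
Proof. by rewrite /alive /= /reached; case: r => [[] []]. Qed.

Lemma type_sum_alive_le r (u : {set edge G1}) :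
  type_sum alive_indicator r u <= D * (r.1 || r.2)%:R.
Proof.
rewrite /D mulr_natl -sumr_const; apply: ler_sum => e _.
rewrite /alive_indicator; case: (boolP (alive _)) => [/alive_status -> //|_].
by case: (_ || _).
Qed.

Lemma mean_alive_le t : N alive_indicator t <= D * alive_indicator t.
Proof. by apply: mean_le => u; exact: type_sum_alive_le. Qed.

(** Each terminal has degree at least two, because two edge-disjoint paths
    leave it; so every reached edge has at least two reached descendants. *)
Lemma two_children r (u : {set edge G1}) : r.1 || r.2 ->
  exists e1 e2, [/\ e1 != e2, alive (status r u e1) & alive (status r u e2)].
Proof.
have ab := dist_gt1_neq G1_dist.
have ba : rb G1 != ra G1 by rewrite eq_sym.
case: r => r1 r2 /orP[/= r11|/= r21].
- have [|e1 [e2 [e12 h1 h2]]] := degree_ge2 G1_paths ab; first by left.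
  exists e1, e2; split=> //; rewrite /alive /= /reached /= r11 /=.
    by case/orP: h1 => /eqP <-; rewrite linked_refl ?orbT.
  by case/orP: h2 => /eqP <-; rewrite linked_refl ?orbT.
- have [|e1 [e2 [e12 h1 h2]]] := degree_ge2 G1_paths ba; first by right.
  exists e1, e2; split=> //; rewrite /alive /= /reached /= r21 /=.
    by case/orP: h1 => /eqP <-; rewrite linked_refl ?orbT.
  by case/orP: h2 => /eqP <-; rewrite linked_refl ?orbT.
Qed.

Lemma type_sum_alive_ge r (u : {set edge G1}) :
  2 * (r.1 || r.2)%:R <= type_sum (@alive_indicator R) r u.
Proof.
case: (boolP (r.1 || r.2)) => [h|_]; last first.
  by rewrite mulr0; apply: sumr_ge0 => e _; exact: ler0n.
have [e1 [e2 [e12 h1 h2]]] := two_children u h.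
rewrite mulr1 /type_sum (bigD1 e1) //= (bigD1 e2) 1?eq_sym //=.
rewrite {1 2}/alive_indicator h1 h2 addrA [X in X <= _]/(1 + 1 : R) lerDl.
by apply: sumr_ge0 => e _; exact: ler0n.
Qed.

Lemma mean_alive_ge t : 2 * alive_indicator t <= N alive_indicator t.
Proof. by apply: mean_ge => u; exact: type_sum_alive_ge. Qed.

Let c0 : R := Num.min p (1 - p) ^+ #|edge G1|.

Let p' : 0 < Num.min p (1 - p).
Proof. by case/andP: p01 => p0 p1; rewrite lt_min p0 subr_gt0. Qed.

Let c0_gt0 : 0 < c0.
Proof. exact: exprn_gt0. Qed.

Let c0_le1 : c0 <= 1.
Proof.
by rewrite exprn_ile1 ?(ltW p') // ge_min; case/andP: p01 => _ /ltW ->.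
Qed.

Lemma perc_weight_min (u : {set edge G1}) : c0 <= perc_weight p u.
Proof.
rewrite /c0 /perc_weight -prodr_const; apply: ler_prod => e _.
by rewrite (ltW p') /=; case: ifP => _; rewrite ge_min lexx ?orbT.
Qed.

(** Every configuration has conditional weight at least [c0], so exhibiting one
    suffices to bound a mean from below. *)
Lemma mean_witness x t (u : {set edge G1}) e : (forall t, 0 <= x t) ->
  linked u (ra G1) (rb G1) = t.1 -> c0 * x (status t.2 u e) <= N x t.
Proof.
move=> x0 ut; rewrite /N /offspring_mean (bigD1 u) //=.
have rest : 0 <= \sum_(v | v != u) cond_weight p t.1 v * type_sum x t.2 v.
  apply: sumr_ge0 => v _; rewrite mulr_ge0 ?cond_weight_ge0 //.
  by apply: sumr_ge0.
apply: ler_wpDr => //; apply: ler_pM; rewrite ?(ltW c0_gt0) //.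
  rewrite /cond_weight ut eqxx ler_pdivlMr ?bern_gt0 //.
  apply: le_trans (perc_weight_min u); rewrite ger_pMr //.
  by rewrite /bern; case/andP: p01 => p0 p1; case: ifP => _; lra.
by rewrite /type_sum (bigD1 e) //= lerDl; apply: sumr_ge0.
Qed.

Let T11 : etype := (true, (true, true)).
Let C11 : etype := (false, (true, true)).

(** Every reached edge can have an open descendant: an open edge through all
    of [G1], a closed one through a single open edge at a reached terminal,
    which does not cross [G1] since the terminals are not adjacent. *)
Lemma mean_open x t : (forall t, 0 <= x t) ->
  c0 * x T11 * alive_indicator t <= N x t.
Proof.
move=> x0; rewrite /alive_indicator; case: (boolP (alive t)); last first.
  by rewrite mulr0 => _; exact: mean_ge0.
case: t => o r; rewrite mulr1 /alive /= => rt.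
suff [u [e [<- eu re]]] : exists u e, [/\ linked u (ra G1) (rb G1) = o,
    e \in u & alive (status r u e)].
  have := @mean_witness x (linked u (ra G1) (rb G1), r) u e x0 erefl.
  rewrite /status eu /=; move: re; rewrite /alive /= -(reached_edge r eu) orbb.
  by move=> ->.
case: o => /=.
  have [e1 [_ [_ h _]]] := two_children [set: edge G1]%SET rt.
  by exists [set: edge G1]%SET, e1; rewrite inE; split => //; exact: G1_connected.
have [e1 [_ [_ h _]]] := two_children finset.set0 rt.
exists [set e1]%SET, e1; split; rewrite ?inE //.
  exact/negbTE/single_edge_not_crossing.
have sub : finset.set0 \subset [set e1]%SET by exact: finset.sub0set.
move: h; rewrite /alive /= /reached.
by case/orP => /orP[] /andP[-> /(linkedS sub) ->]; rewrite ?orbT.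
Qed.

(** The configuration in which all edges but one are open, the closed edge
    being that of [closed_edge_in_crossing]. *)
Lemma mean_closed x : (forall t, 0 <= x t) -> c0 * x C11 <= N x T11.
Proof.
move=> x0; have [e [ab ae be]] := closed_edge_in_crossing G1_dist G1_paths.
have := @mean_witness x T11 [set~ e]%SET e x0 ab.
by rewrite /status !inE eqxx /reached /= ae be.
Qed.

Definition monotone (x : etype -> R) := forall o (r r' : bool * bool),
  r.1 ==> r'.1 -> r.2 ==> r'.2 -> x (o, r) <= x (o, r').

Lemma mean_monotone x : monotone x -> monotone (N x).
Proof.
move=> xm o r r' h1 h2; apply: ler_sum => u _.
rewrite ler_wpM2l ?cond_weight_ge0 //; apply: ler_sum => e _.
have sub v : reached r u v ==> reached r' u v.
  rewrite /reached; move: h1 h2; case: r r' => [[] []] [[] []] //= _ _;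
  by rewrite ?orbF ?implybb //; do 2 case: linked.
by apply: xm; exact: sub.
Qed.

Let y k := iter k N alive_indicator.

Lemma y_ge0 k t : 0 <= y k t.
Proof.
by elim: k t => [|k IH] t; [exact: ler0n | exact: mean_ge0].
Qed.

Lemma y_monotone k : monotone (y k).
Proof.
elim: k => [|k IH]; last exact: mean_monotone.
move=> o [s t] [s' t'] /= h1 h2; rewrite /y /alive_indicator /alive /= ler_nat.
by move: h1 h2; case: s; case: t; case: s'; case: t'.
Qed.

Lemma y_dead k t : ~~ alive t -> y k t = 0.
Proof.
move=> tdead; apply/le_anti; rewrite y_ge0 andbT.
suff : y k t <= D ^+ k * alive_indicator t.
  by rewrite /alive_indicator (negbTE tdead) mulr0.
elim: k => [|k IH] in t {tdead} *; first by rewrite mul1r.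
apply: (@le_trans _ _ (D ^+ k * N alive_indicator t)).
  have D0 : 0 <= D by exact: ler0n.
  by apply: positive_operator_upper IH t; [exact: mean_linear | exact: mean_ge0].
rewrite exprSr -mulrA ler_wpM2l ?exprn_ge0 ?ler0n //; exact: mean_alive_le.
Qed.

Let M k : R := Num.max (y k T11) (y k C11).

Let y_le_M k t : y k t <= M k * alive_indicator t.
Proof.
case: (boolP (alive t)) => h; last by rewrite y_dead // mulr_ge0 ?ler0n // le_max y_ge0.
rewrite /alive_indicator h mulr1 le_max; case: t h => [[] r] _.
  by rewrite (@y_monotone k true r (true, true)) ?implybT.
by rewrite (@y_monotone k false r (true, true)) ?implybT ?orbT.
Qed.

Let MS k : M k.+1 <= D * M k.
Proof.
have h t : y k.+1 t <= M k * N alive_indicator t.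
  by apply: positive_operator_upper (@y_le_M k) t; [exact: mean_linear | exact: mean_ge0].
have M0 : 0 <= M k by rewrite le_max y_ge0.
rewrite /M ge_max; apply/andP; split; apply: le_trans (h _) _;
  rewrite mulrC ler_wpM2r //; apply: le_trans (mean_alive_le _) _;
  by rewrite mulr1.
Qed.

Let M_le k : c0 * M k <= y k.+1 T11.
Proof.
have := @mean_open _ T11 (@y_ge0 k); rewrite mulr1.
have := mean_closed (@y_ge0 k); rewrite /M.
by case: (leP (y k T11) (y k C11)) => _ h1 h2; [exact: h1 | exact: h2].
Qed.

Let D_ge2 : 2 <= D.
Proof.
have := mean_alive_ge T11; have := mean_alive_le T11.
by rewrite !mulr1 => h /le_trans; apply.
Qed.

Let delta := c0 ^+ 2 / D ^+ 2.

(** From the first generation on, the [y k t] with [t] reached are comparable up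
    to constants: by [monotone] the largest of them is one of the two types with both endvertices reached, [mean_closed]
    compares these two one generation apart, and [mean_open] compares any type
    with the open one. *)
Lemma harnack k x : (forall t, 0 <= x t) -> forall t,
  delta * y k.+2 t * x T11 <= y k.+1 T11 * N x t.
Proof.
move=> x0 t; have D0 : 0 < D by apply: lt_le_trans D_ge2.
have h1 : y k.+2 t <= D ^+ 2 / c0 * y k.+1 T11 * alive_indicator t.
  apply: le_trans (y_le_M _ _) _; rewrite ler_wpM2r ?ler0n //.
  apply: le_trans (MS _) _; rewrite expr2 -!mulrA ler_wpM2l ?(ltW D0) //.
  apply: le_trans (MS _) _; rewrite ler_wpM2l ?(ltW D0) // mulrC ler_pdivlMr //.
  by rewrite mulrC; exact: M_le.
have h2 := mean_open t x0.
apply: (@le_trans _ _ (delta * (D ^+ 2 / c0 * y k.+1 T11 * alive_indicator t) * x T11)).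
  rewrite ler_wpM2r // ler_wpM2l //.
  exact: divr_ge0 (exprn_ge0 _ (ltW c0_gt0)) (exprn_ge0 _ (ltW D0)).
have -> : delta * (D ^+ 2 / c0 * y k.+1 T11 * alive_indicator t) * x T11 =
    y k.+1 T11 * (c0 * x T11 * alive_indicator t).
  by rewrite /delta; field; rewrite !gt_eqF.
by rewrite ler_wpM2l ?y_ge0.
Qed.

Lemma mean_cluster_growth : exists rho C g c, [/\ 2 <= rho, 0 < g < 1, 0 < c, 0 < C &
  forall k t, `|y k.+1 t - rho * y k t| <= C * g ^+ k * rho ^+ k * alive_indicator t
  /\ c * rho ^+ k * alive_indicator t <= y k t <= C * rho ^+ k * alive_indicator t].
Proof.
have D0 : 0 < D by apply: lt_le_trans D_ge2.
have d01 : 0 < delta < 1.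
  rewrite divr_gt0 ?exprn_gt0 //= ltr_pdivrMr ?exprn_gt0 // mul1r.
  apply: (@le_lt_trans _ _ 1); first by rewrite exprn_ile1 ?(ltW c0_gt0).
  by rewrite exprn_egt1 //; apply: lt_le_trans D_ge2; rewrite ltr1n.
have := @ratio_limit R etype N alive_indicator T11 D delta mean_linear mean_ge0
  (fun t => ler0n _ _) mean_alive_ge mean_alive_le _ d01 harnack.
case; first exact: ltr01.
move=> rho [C [g [rho2 g01 C0 hC]]].
have [c [C' [c0' C'0 hcC]]] := geometric_growth rho2 g01 C0.
have hy t := hcC (fun k => y k t) (fun k => y_ge0 k t)
  (fun k => iter_lo mean_linear mean_ge0 mean_alive_ge k t) (fun k => hC k t).
have [g0 g1] := andP g01.
have rk k : 0 < rho ^+ k by rewrite exprn_gt0 //; lra.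
exists rho, (C * C' + C'), g, c; split => // [|k t].
  by rewrite ltr_wpDl // mulr_ge0 // ltW.
have /andP[lo hi] := hy t k.
have a0 : 0 <= alive_indicator t :> R by exact: ler0n.
split.
  apply: le_trans (hC k t) _.
  apply: (@le_trans _ _ (C * g ^+ k * (C' * rho ^+ k * alive_indicator t))).
    by rewrite ler_wpM2l // mulr_ge0 // exprn_ge0 // ltW.
  have -> : C * g ^+ k * (C' * rho ^+ k * alive_indicator t) =
    C * C' * (g ^+ k * rho ^+ k * alive_indicator t) by ring.
  have -> : (C * C' + C') * g ^+ k * rho ^+ k * alive_indicator t =
    (C * C' + C') * (g ^+ k * rho ^+ k * alive_indicator t) by ring.
  rewrite ler_wpM2r ?lerDl ?(ltW C'0) //.
  by rewrite !mulr_ge0 ?(ltW (rk _)) ?exprn_ge0 // ltW.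
rewrite lo /=; apply: le_trans hi _.
rewrite -!(mulrA _ (rho ^+ k)) ler_wpM2r ?mulr_ge0 ?(ltW (rk _)) //.
by rewrite lerDr mulr_ge0 // ltW.
Qed.

End Growth.

(** * Percolation off an edge and the mean matrix *)

Section RemoveEdge.
Variables (R : realType) (p : R) (G : ograph) (e' : edge G).
Let G' := remove_edge e'.
Implicit Types (w : {set edge G'}).

Definition restore (b : bool) w : {set edge G} :=
  [set f | if insub f is Some f' then (f' : edge G') \in w else b]%SET.

Let restore_val b w (f : edge G') : (val f \in restore b w) = (f \in w).
Proof. by rewrite inE valK. Qed.

Let restore_e b w : (e' \in restore b w) = b.
Proof. by rewrite inE insubF // eqxx. Qed.

Lemma perc_weight_restore b w :
  perc_weight p (restore b w) = bern p b * perc_weight p w.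
Proof.
rewrite /perc_weight (bigD1 e') //= restore_e; congr (_ * _).
rewrite (big_sub [pred f | f != e']).
by apply: eq_bigr => f _; rewrite restore_val.
Qed.

Lemma perc_expect_restore (X : {set edge G} -> R) :
  perc_expect p X =
  perc_expect p (fun w => p * X (restore true w) + (1 - p) * X (restore false w)).
Proof.
rewrite /perc_expect (bigID (fun u : {set edge G} => e' \in u)) /=.
under [RHS]eq_bigr do rewrite mulrDr.
rewrite big_split /=.
have split b : \sum_(u : {set edge G} | (e' \in u) == b) perc_weight p u * X u =
    \sum_(w : {set edge G'}) perc_weight p w * (bern p b * X (restore b w)).
  rewrite (reindex (restore b)) /=; last first.
    exists (fun u : {set edge G} =>
      [set f : {e : edge G | e != e'} | val f \in u]%SET) => [w _|u].
      by apply/setP => f; rewrite inE restore_val.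
    rewrite inE => /eqP ub; apply/setP => f; rewrite inE.
    by case: insubP => [f' _ <-|]; [rewrite inE | rewrite negbK => /eqP ->].
  apply: eq_big => [w|w _]; first by rewrite restore_e eqxx.
  by rewrite perc_weight_restore mulrA [perc_weight _ _ * _]mulrC.
have := split true; have := split false; rewrite /bern => <- <-.
by congr (_ + _); apply: eq_bigl => u; case: (_ \in _).
Qed.

Lemma linked_restore_closed w x y :
  linked (restore false w) x y = linked w x y.
Proof.
apply/idP/idP => xy.
- rewrite -(@linked_ind _ (restore false w) (@linked G' w x) x y) ?linked_refl //.
  move=> f; rewrite inE; case: insubP => // f' _ <- /linked_edge h.
  apply/idP/idP => h'; first exact: linked_trans h' h.
  by apply: linked_trans h' _; rewrite linked_sym.
- rewrite -(@linked_ind G' w (@linked G (restore false w) x) x y) ?linked_refl //.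
  move=> f; rewrite -(restore_val false) => /linked_edge h.
  apply/idP/idP => h'; first exact: linked_trans h' h.
  by apply: linked_trans h' _; rewrite linked_sym.
Qed.

Definition off_state r w : bool * bool :=
  (@reached G' r w (src e'), @reached G' r w (tgt e')).

Lemma status_restore_closed r w :
  status r (restore false w) e' = (false, off_state r w).
Proof. by rewrite /status restore_e /reached !linked_restore_closed. Qed.

(** Opening an edge joins its endvertices, so it is reached as soon as one of
    them is reached by the other edges. *)
Lemma status_restore_open r w : status r (restore true w) e' =
  (true, let s := off_state r w in (s.1 || s.2, s.1 || s.2)).
Proof.
set u := restore true w.
have eu : e' \in u by rewrite restore_e.
have sub : restore false w \subset u.
  by apply/fintype.subsetP => f; rewrite !inE; case: insubP.
have offE v : @reached G' r w v = reached r (restore false w) v.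
  by rewrite /reached !linked_restore_closed.
have mono v : reached r (restore false w) v -> reached r u v.
  by rewrite /reached => /orP[] /andP[-> /(linkedS sub) ->]; rewrite ?orbT.
suff -> : status r u e' = (true, (reached r u (src e'), reached r u (src e'))).
  rewrite /off_state /= !offE.
  have -> // : reached r u (src e') = reached r (restore false w) (src e') ||
      reached r (restore false w) (tgt e').
  apply/idP/orP => [|[/mono //|/mono]]; last by rewrite -reached_edge.
  have [hs|ns] := boolP (reached r (restore false w) (src e')); first by left.
  have [ht|nt] := boolP (reached r (restore false w) (tgt e')); first by right.
  move=> su; exfalso; move: (ns).
  have inv f : f \in u ->
      reached r (restore false w) (src f) = reached r (restore false w) (tgt f).
    move=> fu; have [->|fe] := eqVneq f e'; first by rewrite (negbTE ns) (negbTE nt).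
    apply: reached_edge; move: fu; rewrite !inE.
    by case: insubP => // /negP[].
  case/orP: su => /andP[rr /(linked_ind inv) <-].
    by rewrite /reached rr linked_refl.
  by rewrite /reached rr linked_refl orbT.
by rewrite /status restore_e -reached_edge.
Qed.

End RemoveEdge.

Section MeanMatrix.
Variables (R : realType) (p : R) (G1 : ograph).
Hypothesis p01 : 0 < p < 1.

Let N := offspring_mean p G1.
Let M := mean_matrix G1 p.

(** Value at an edge of which only the connections made by the other edges are
    known, its own state being still to be drawn. *)
Definition fresh_average (x : etype -> R) (r : bool * bool) : R :=
  p * x (true, (r.1 || r.2, r.1 || r.2)) + (1 - p) * x (false, r).

(** Averaging over the state of the replaced edge undoes the conditioning of its
    copy.  In a crossed copy it does not matter from which terminal one starts,
    which is why an open edge counts as reached at both ends. *)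
Lemma fresh_average_mean_percolation x r :
  fresh_average (N x) r = perc_expect p (fun u : {set edge G1} => type_sum x r u).
Proof.
rewrite /fresh_average /perc_expect (bigID (fun u => linked u (ra G1) (rb G1))) /=.
have bernK o c : bern p o * (c / bern p o) = c.
  by rewrite mulrC divfK // gt_eqF ?bern_gt0.
have condE o r' : bern p o * N x (o, r') =
    \sum_(u : {set edge G1} | linked u (ra G1) (rb G1) == o)
      perc_weight p u * type_sum x r' u.
  rewrite /N /offspring_mean mulr_sumr [RHS]big_mkcond /=; apply: eq_bigr => u _.
  rewrite /cond_weight; case: ifP => _; last by rewrite mul0r mulr0.
  by rewrite mulrA bernK.
have := condE true (r.1 || r.2, r.1 || r.2); rewrite {1}/bern => ->.
have := condE false r; rewrite {1}/bern => ->.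
congr (_ + _); last by apply: eq_bigl => u; case: (linked _ _ _).
apply: eq_big => [u|u /eqP ab]; first by case: (linked _ _ _).
congr (_ * _); apply: eq_bigr => e _; congr x.
have same v : reached (r.1 || r.2, r.1 || r.2) u v = reached r u v.
  rewrite /reached /=.
  have -> : linked u (rb G1) v = linked u (ra G1) v.
    apply/idP/idP; first exact: linked_trans.
    by apply: linked_trans; rewrite linked_sym.
  by rewrite -!andb_orl orbb.
by rewrite /status !same.
Qed.

Lemma fresh_average_mean x r : fresh_average (N x) r =
  \sum_(e' : edge G1) perc_expect p (fun w => fresh_average x (@off_state _ e' r w)).
Proof.
rewrite fresh_average_mean_percolation /perc_expect.
under eq_bigr do rewrite mulr_sumr.
rewrite exchange_big /=; apply: eq_bigr => e' _.
rewrite -/(perc_expect p (fun u => x (status r u e'))) (@perc_expect_restore R p G1 e').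
apply: eq_bigr => w _; congr (_ * _).
by rewrite status_restore_open status_restore_closed.
Qed.

Definition endpoint_form (c : 'cV[R]_3) (r : bool * bool) : R :=
  r.1%:R * c 0 0 + r.2%:R * c 1 0 + (r.1 || r.2)%:R * c ord_max 0.

Lemma sum3 (F : 'I_3 -> R) : \sum_i F i = F 0 + F 1 + F ord_max.
Proof.
rewrite !big_ord_recl big_ord0 addr0 addrA.
by congr (F _ + F _ + F _); apply: val_inj.
Qed.

(** In these coordinates the averaged recursion is multiplication by the mean
    matrix: the three functionals record whether each of the sets $S_1$, $S_2$,
    $S_3$ meets the cluster. *)
Lemma endpoint_form_mean c r :
  \sum_(e' : edge G1) perc_expect p (fun w => endpoint_form c (@off_state _ e' r w)) =
  endpoint_form (M *m c) r.
Proof.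
pose S (e' : edge G1) j (w : {set edge (remove_edge e')}) : bool :=
  r.1 && @linked_set (remove_edge e') w (root_set e' j) (ra G1) ||
  r.2 && @linked_set (remove_edge e') w (root_set e' j) (rb G1).
have cfE (c' : 'cV[R]_3) : endpoint_form c' r =
    \sum_i (nth false [:: r.1; r.2; r.1 || r.2] (val i))%:R * c' i 0.
  by rewrite sum3.
have SE e' j w : (S e' j w)%:R = \sum_(i < 3)
    (nth false [:: r.1; r.2; r.1 || r.2] (val i))%:R *
    (@mean_event G1 e' i j w)%:R :> R.
  rewrite sum3 /mean_event /S /=.
  case: linked_set; case: linked_set; case: (r.1); case: (r.2) => /=; ring.
have offE e' w : endpoint_form c (@off_state _ e' r w) =
    \sum_(j < 3) (S e' j w)%:R * c j 0.
  rewrite sum3 /endpoint_form /S /=.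
  have ls1 x y : @linked_set (remove_edge e') w [set x]%SET y =
      @linked (remove_edge e') w y x.
    rewrite linked_sym; apply/existsP/idP => [[z]|h].
      by rewrite inE => /andP[/eqP ->].
    by exists x; rewrite inE eqxx.
  have ls2 x x' y : @linked_set (remove_edge e') w [set x; x']%SET y =
      @linked (remove_edge e') w y x || @linked (remove_edge e') w y x'.
    rewrite -!ls1; apply/existsP/orP => [[z]|[]].
    - by rewrite !inE => /andP[/orP[] /eqP -> h]; [left|right];
        apply/existsP; [exists x|exists x']; rewrite inE eqxx.
    - by case/existsP => z; rewrite inE => /andP[/eqP -> h]; exists x;
        rewrite !inE eqxx.
    - by case/existsP => z; rewrite inE => /andP[/eqP -> h]; exists x';
        rewrite !inE eqxx orbT.
  rewrite /root_set /= !ls1 !ls2 /reached /=.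
  congr (_ + _ + _ * _); congr (_%:R).
  by rewrite !andb_orr orbACA.
rewrite cfE; under [RHS]eq_bigr => i _.
  rewrite mxE; under eq_bigr => j _ do
    rewrite /M /mean_matrix summxE mulr_suml.
  rewrite exchange_big mulr_sumr /=.
over.
rewrite [RHS]exchange_big /=; apply: eq_bigr => e' _.
transitivity (\sum_(w : {set edge (remove_edge e')}) \sum_(i < 3) \sum_(j < 3)
    perc_weight p w * ((nth false [:: r.1; r.2; r.1 || r.2] (val i))%:R *
    (@mean_event G1 e' i j w)%:R * c j 0)).
  apply: eq_bigr => w _; rewrite offE mulr_sumr.
  under eq_bigr do rewrite SE mulr_suml mulr_sumr.
  by rewrite exchange_big.
rewrite exchange_big /=; apply: eq_bigr => i _.
rewrite exchange_big mulr_sumr /=; apply: eq_bigr => j _.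
rewrite mxE /perc_prob [in RHS]big_mkcond mulr_suml mulr_sumr; apply: eq_bigr => w _ /=.
by case: mean_event => /=; ring.
Qed.

Lemma fresh_average_iter x c : (forall r, fresh_average x r = endpoint_form c r) ->
  forall k r, fresh_average (iter k N x) r = endpoint_form (M ^+ k *m c) r.
Proof.
move=> xc; elim=> [|k IH] r; first by rewrite expr0 mul1mx.
rewrite iterS fresh_average_mean exprS -mulmxA -endpoint_form_mean.
by apply: eq_bigr => e' _; apply: eq_bigr => w _; rewrite IH.
Qed.

End MeanMatrix.

(** * The growth rate is the Perron-Frobenius eigenvalue *)

Lemma le0_geometric (R : realType) (a K g : R) : 0 <= g < 1 ->
  (forall k, a <= K * g ^+ k) -> a <= 0.
Proof.
move=> /andP[g0 g1] h.
have cv : ((fun k => K * g ^+ k) @ \oo --> K * 0)%classic.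
  by apply: cvgMr; apply: cvg_expr; rewrite ger0_norm.
rewrite -[leRHS](mulr0 K) -(cvg_lim _ cv) //.
by apply: limr_ge; [exact: cvgP cv | near=> k].
Unshelve. all: by end_near. Qed.

Section Criticality.
Variables (R : realType) (p : R) (G1 : ograph).
Hypothesis p01 : 0 < p < 1.
Hypothesis G1_dist : (1 < gdist (ra G1) (rb G1))%N.
Hypothesis p_fixed : cross_prob G1 p = p.

Let N := offspring_mean p G1.
Let M := mean_matrix G1 p.
Let y k := iter k N alive_indicator.
Let ra_neq_rb := dist_gt1_neq G1_dist.

Lemma perc_expect_single (X : {set edge single_edge} -> R) :
  perc_expect p X = p * X [set: edge single_edge]%SET + (1 - p) * X finset.set0.
Proof.
have all_or_none (w : {set edge single_edge}) :
    w = (if tt \in w then finset.setT else finset.set0).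
  by apply/setP => -[]; case: ifP => tw; rewrite inE.
rewrite /perc_expect (reindex (fun b => if b then [set: edge single_edge]%SET
  else finset.set0)) /=; last first.
  exists (fun w : {set edge single_edge} => tt \in w) => [[] _|w _];
  by rewrite ?inE // -all_or_none.
rewrite big_bool /= /perc_weight !(big_pred1 tt) ?inE //; by case.
Qed.

Lemma type_sum_single x (w : {set edge single_edge}) :
  type_sum x (true, true) w = x (tt \in w, (true, true)) :> R.
Proof.
rewrite /type_sum (big_pred1 tt); last by case.
by rewrite /status /reached /= !linked_refl orbT.
Qed.

Lemma expect_type_sum k x :
  perc_expect (G := hgraph G1 k) p (type_sum x (true, true)) =
  fresh_average p (iter k N x) (true, true).
Proof.
elim: k x => [|k IH] x; last by rewrite expect_type_sum_subst // IH iterSr.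
by rewrite perc_expect_single !type_sum_single !inE.
Qed.

Lemma cayley_hamilton_sum c k :
  \sum_(i < size (char_poly M)) (char_poly M)`_i *: (M ^+ (k + i) *m c) = 0
    :> 'cV[R]_3.
Proof.
have := Cayley_Hamilton M; rewrite -{1}[char_poly M]coefK poly_def raddf_sum /=.
move=> /(congr1 (fun A => (M ^+ k *m A) *m c)).
rewrite mulmx0 mul0mx mulmx_sumr mulmx_suml => h; rewrite -[RHS]h.
apply: eq_bigr => i _; rewrite linearZ /= rmorphXn /= horner_mx_X -scalemxAr -scalemxAl.
by rewrite exprD.
Qed.

Lemma endpoint_form_sum (I : finType) (a : I -> R) (c : I -> 'cV[R]_3) r :
  endpoint_form (\sum_i a i *: c i) r = \sum_i a i * endpoint_form (c i) r.
Proof.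
rewrite /endpoint_form !summxE !mulr_sumr -!big_split; apply: eq_bigr => i _ /=.
by rewrite !mxE; ring.
Qed.

Let e3 : 'cV[R]_3 := delta_mx ord_max 0.
Let s k := fresh_average p (y k) (true, true).

(** By the Cayley-Hamilton theorem, [s k] being a linear form in the [k]-th power
    of the mean matrix. *)
Lemma s_recurrence k :
  \sum_(i < size (char_poly M)) (char_poly M)`_i * s (k + i) = 0.
Proof.
have avE r : fresh_average p (@alive_indicator R) r = endpoint_form e3 r.
  by rewrite /fresh_average /endpoint_form /e3 !mxE /= /alive_indicator /alive /= orbb; ring.
transitivity (endpoint_form (0 : 'cV[R]_3) (true, true)); last first.
  by rewrite /endpoint_form !mxE !mulr0 !addr0.
rewrite -(cayley_hamilton_sum e3 k) endpoint_form_sum; apply: eq_bigr => i _.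
by rewrite /s (fresh_average_iter G1 p01 avE).
Qed.

(** Dividing the recurrence of the mean cluster sizes by the size itself and
    passing to the limit shows that [rho] is a root of the characteristic
    polynomial.  Conversely the column sums of the powers of the mean matrix are
    means of weights bounded by the cluster indicator, hence $O(\rho^k)$, which
    excludes a real eigenvalue larger than [rho]. *)
Lemma growth_rate_eigenvalue rho C g c d : is_PF_eigenvalue M d ->
  2 <= rho -> 0 < g < 1 -> 0 < c -> 0 < C ->
  (forall k t, `|y k.+1 t - rho * y k t| <= C * g ^+ k * rho ^+ k * alive_indicator t
    /\ c * rho ^+ k * alive_indicator t <= y k t <= C * rho ^+ k * alive_indicator t) ->
  d = rho.
Proof.
move=> [dM dmax] rho2 /andP[g0 g1] c0 C0 hy.
have rho0 : 0 < rho by lra.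
have [p0 p1] := andP p01.
have s_step k : `|s k.+1 - rho * s k| <= C * g ^+ k * rho ^+ k.
  have [+ _] := hy k (true, (true, true)); have [+ _] := hy k (false, (true, true)).
  rewrite !mulr1 !ler_norml /s /fresh_average /= => /andP[h1 h2] /andP[h3 h4].
  set B := C * _ * _ in h1 h2 h3 h4 *; apply/andP; split; nra.
have s_lo k : c * rho ^+ k <= s k.
  have [_] := hy k (true, (true, true)); have [_] := hy k (false, (true, true)).
  rewrite !mulr1 /s /fresh_average /= => /andP[h1 _] /andP[h3 _]; nra.
have s_shift k i : `|s (k + i) - rho ^+ i * s k| <=
    i%:R * (C * rho ^+ i / rho) * (g ^+ k * rho ^+ k).
  elim: i => [|i IH]; first by rewrite addn0 expr0 mul1r subrr normr0 !mul0r.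
  have -> : s (k + i.+1) - rho ^+ i.+1 * s k =
      (s (k + i).+1 - rho * s (k + i)) + rho * (s (k + i) - rho ^+ i * s k).
    by rewrite addnS exprS; ring.
  apply: le_trans (ler_normD _ _) _; rewrite normrM (gtr0_norm rho0).
  rewrite -natr1 mulrDl mulrDl mul1r addrC lerD //.
    rewrite exprS; apply: le_trans (ler_wpM2l (ltW rho0) IH) _.
    by rewrite le_eqVlt; apply/orP; left; apply/eqP; ring.
  apply: le_trans (s_step _) _; rewrite !exprD exprS.
  have -> : C * (rho * rho ^+ i) / rho * (g ^+ k * rho ^+ k) =
    C * g ^+ k * (rho ^+ k * rho ^+ i) * 1 by field; rewrite gt_eqF.
  have -> : C * (g ^+ k * g ^+ i) * (rho ^+ k * rho ^+ i) =
    C * g ^+ k * (rho ^+ k * rho ^+ i) * g ^+ i by ring.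
  rewrite ler_wpM2l ?exprn_ile1 ?(ltW g0) ?(ltW g1) //.
  by rewrite !mulr_ge0 ?exprn_ge0 ?(ltW g0) ?(ltW C0) ?(ltW rho0).
have rho_eig : eigenvalue M rho.
  rewrite eigenvalue_root_char rootE horner_coef; set q := char_poly M.
  set X := \sum_(i < _) _.
  pose K := \sum_(i < size q) `|q`_i| * (i%:R * (C * rho ^+ i / rho)).
  rewrite -normr_le0 -(pmulr_lle0 _ c0).
  apply: (@le0_geometric _ _ K g) => [|k]; first by rewrite (ltW g0).
  have rk : 0 < rho ^+ k by rewrite exprn_gt0.
  rewrite -(ler_pM2r rk) -mulrA.
  apply: (@le_trans _ _ (`|X| * s k)); first by rewrite ler_wpM2l.
  have s0 : 0 <= s k by apply: le_trans (s_lo k); rewrite mulr_ge0 // ltW.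
  rewrite -[s k]ger0_norm // -normrM.
  have -> : X * s k = \sum_(i < size q) q`_i * (rho ^+ i * s k - s (k + i)).
    under [RHS]eq_bigr do rewrite mulrBr.
    rewrite sumrB s_recurrence subr0 mulr_suml.
    by apply: eq_bigr => i _; rewrite mulrA.
  apply: le_trans (ler_norm_sum _ _ _) _.
  rewrite -mulrA /K mulr_suml; apply: ler_sum => i _.
  by rewrite normrM distrC -[leRHS]mulrA ler_wpM2l.
apply/le_anti/andP; split; last first.
  have : eigenvalue (map_mx (real_complex R) M) (real_complex R rho).
    by rewrite eigenvalue_map.
  by move=> /dmax; rewrite ger0_norm ?complex.ler0c ?complex.lecR // ltW.
rewrite leNgt; apply/negP => rd.
have d0 : 0 < d by lra.
have [v vM v0] := eigenvalueP dM.
have vMk k : v *m M ^+ k = d ^+ k *: v.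
  elim: k => [|k IH]; first by rewrite !expr0 mulmx1 scale1r.
  by rewrite exprS mulmxA vM -scalemxAl IH scalerA exprSr mulrC.
have [j vj0] : exists j, v 0 j != 0.
  apply/existsP; apply: contraNT v0 => /existsPn h; apply/eqP/rowP => j.
  by rewrite mxE; apply/eqP; have := h j; rewrite negbK.
have M0 i1 i2 : 0 <= M i1 i2.
  rewrite /M /mean_matrix summxE; apply: sumr_ge0 => e _; rewrite mxE.
  by apply: sumr_ge0 => w _; rewrite ltW // perc_weight_gt0.
have Mk0 k i1 i2 : 0 <= (M ^+ k) i1 i2.
  elim: k i1 i2 => [|k IH] i1 i2; first by rewrite expr0 mxE; case: (_ == _).
  by rewrite exprS mxE; apply: sumr_ge0 => l _; rewrite mulr_ge0.
(* Drawing the state of the edge turns this weight into the j-th coordinate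
   form: for j = 0, 1 it sits on the closed edges whose source, respectively
   target, is reached. *)
pose x (t : etype) : R := nth 0 [:: (~~ t.1 && t.2.1)%:R / (1 - p);
  (~~ t.1 && t.2.2)%:R / (1 - p); alive_indicator t] j.
have p'0 : 0 < 1 - p by lra.
have avx r : fresh_average p x r = endpoint_form (delta_mx j 0) r.
  rewrite /fresh_average /endpoint_form /x !mxE /alive_indicator /alive /= orbb.
  by case: j {vj0 x} => [[|[|[|//]]] ?] /=; field; rewrite ?gt_eqF //.
have xle t : x t <= (1 - p)^-1 * alive_indicator t.
  have hp : 1 <= (1 - p)^-1 by rewrite invf_ge1 //; lra.
  rewrite /x /alive_indicator /alive; case: j {vj0 x avx} => [[|[|[|//]]] ?] /=;
    case: t => [[] [[] []]] /=; rewrite ?mul0r ?mulr0 ?mulr1 ?mul1r //;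
    lra.
have colsum k : \sum_i (M ^+ k) i j <= (1 - p)^-1 * C * rho ^+ k.
  have -> : \sum_i (M ^+ k) i j = fresh_average p (iter k N x) (true, true).
    rewrite (fresh_average_iter G1 p01 avx) sum3 /endpoint_form /= !mul1r.
    by rewrite -!colE !mxE.
  have xk t : iter k N x t <= (1 - p)^-1 * y k t.
    elim: k t => [|k IH] t; first exact: xle.
    by apply: positive_operator_upper IH t; [exact: mean_linear | exact: mean_ge0].
  have yC t : y k t <= C * rho ^+ k.
    have [_ /andP[_ h]] := hy k t; apply: le_trans h _.
    rewrite ler_piMr ?mulr_ge0 ?exprn_ge0 ?(ltW C0) ?(ltW rho0) //.
    by rewrite /alive_indicator; case: (alive t).
  have h t : iter k N x t <= (1 - p)^-1 * C * rho ^+ k.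
    by apply: le_trans (xk t) _; rewrite -mulrA ler_wpM2l ?invr_ge0 ?(ltW p'0).
  have := h (true, (true, true)); have := h (false, (true, true)).
  rewrite /fresh_average /=; nra.
suff : `|v 0 j| <= 0 by rewrite normr_le0 (negbTE vj0).
pose V := \sum_i `|v 0 i|.
apply: (@le0_geometric _ _ (V * ((1 - p)^-1 * C)) (rho / d)) => [|k].
  by rewrite divr_ge0 ?ltW //= ltr_pdivrMr // mul1r.
rewrite expr_div_n mulrA ler_pdivlMr ?exprn_gt0 // mulrC -mulrA.
have -> : d ^+ k * `|v 0 j| = `|(v *m M ^+ k) 0 j|.
  by rewrite vMk mxE normrM ger0_norm // exprn_ge0 // ltW.
rewrite mxE; apply: le_trans (ler_norm_sum _ _ _) _.
rewrite /V mulr_suml; apply: ler_sum => i _; rewrite normrM ler_wpM2l //.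
rewrite ger0_norm //; apply: le_trans (colsum k).
by rewrite (bigD1 i) //= lerDl; apply: sumr_ge0.
Qed.

End Criticality.

(** * Second moments *)

Section SecondMoment.
Variables (R : realType) (p : R) (G1 : ograph).
Hypothesis p01 : 0 < p < 1.
Hypothesis G1_dist : (1 < gdist (ra G1) (rb G1))%N.
Hypothesis p_fixed : cross_prob G1 p = p.

Let N := offspring_mean p G1.
Let D : R := #|edge G1|%:R.
Let y k := iter k N alive_indicator.
Let both := (true, true).
Let ra_neq_rb := dist_gt1_neq G1_dist.

Let S k (x : etype -> R) :=
  perc_expect (G := hgraph G1 k) p (fun w => type_sum x both w ^+ 2).
Let s k := perc_expect (G := hgraph G1 k) p (type_sum alive_indicator both).

Lemma type_sum_sqr_le x r (u : {set edge G1}) m : (0 <= m) ->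
  (forall t, `|x t| <= m * alive_indicator t) ->
  type_sum x r u ^+ 2 <= (m * D) ^+ 2 * (r.1 || r.2)%:R.
Proof.
move=> m0 xm.
have h : `|type_sum x r u| <= m * D * (r.1 || r.2)%:R.
  apply: le_trans (ler_norm_sum _ _ _) _.
  apply: (@le_trans _ _ (m * type_sum alive_indicator r u)).
    by rewrite /type_sum mulr_sumr; apply: ler_sum => e _; exact: xm.
  by rewrite -mulrA ler_wpM2l // type_sum_alive_le.
rewrite -real_normK ?num_real //.
apply: (@le_trans _ _ ((m * D * (r.1 || r.2)%:R) ^+ 2)).
  by rewrite lerXn2r ?nnegrE // mulr_ge0 // mulr_ge0 // ler0n.
by rewrite exprMn; case: (_ || _); rewrite ?expr1n ?expr0n.
Qed.

Lemma expect_offspring_square_le k x m : 0 <= m ->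
  (forall t, `|x t| <= m * alive_indicator t) ->
  perc_expect (G := hgraph G1 k) p (type_sum (offspring_square p G1 x) both) <=
  (m * D) ^+ 2 * s k.
Proof.
move=> m0 xm; rewrite /s -perc_expectZ; apply: ler_perc_expect => // w.
rewrite /type_sum mulr_sumr; apply: ler_sum => e _.
move: (status _ _ _) => t.
rewrite -[leRHS]mul1r -(sum_cond_weight p01 p_fixed t.1) mulr_suml.
apply: ler_sum => u _; rewrite ler_wpM2l ?cond_weight_ge0 //.
exact: type_sum_sqr_le.
Qed.

(** Iterating [expect_square_subst]: the fluctuations created [j] generations
    before the end are transported by the [j]-th iterate of the mean operator. *)
Lemma second_moment_bound k x (m : nat -> R) : (forall j, 0 <= m j) ->
  (forall j t, `|iter j N x t| <= m j * alive_indicator t) ->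
  S k x <= m k ^+ 2 + \sum_(j < k) (m j * D) ^+ 2 * s (k - j.+1).
Proof.
elim: k x m => [|k IH] x m m0 xm.
  rewrite big_ord0 addr0 /S perc_expect_single !type_sum_single.
  have h t : x t ^+ 2 <= m 0%N ^+ 2.
    rewrite -real_normK ?num_real // lerXn2r ?nnegrE //.
    apply: le_trans (xm 0%N t) _; rewrite ler_piMr //.
    by rewrite /alive_indicator; case: alive.
  have := h (true, (true, true)); have := h (false, (true, true)).
  by rewrite !inE; case/andP: p01 => p0 p1; nra.
have := @expect_square_subst R p p01 G1 ra_neq_rb p_fixed (hgraph G1 k) x (fun=> 0) both.
have -> : perc_expect p (fun W : {set edge (subst_graph (hgraph G1 k) G1)} =>
    (type_sum x both W + type_sum (fun=> 0) both (coarsen (fibres W))) ^+ 2) =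
    S k.+1 x.
  by apply: eq_bigr => w _; rewrite [X in _ + X]big1 ?addr0.
have -> : perc_expect p (fun w : {set edge (hgraph G1 k)} =>
    type_sum (fun t => offspring_mean p G1 x t + 0) both w ^+ 2) = S k (N x).
  by apply: eq_bigr => w _; congr (_ * _ ^+ 2); apply: eq_bigr => e _; rewrite addr0.
move=> h; apply: le_trans h _.
have h1 := IH (N x) (fun j => m j.+1) (fun j => m0 j.+1).
have {}h1 : S k (N x) <=
    m k.+1 ^+ 2 + \sum_(j < k) (m j.+1 * D) ^+ 2 * s (k - j.+1).
  by apply: h1 => j t; rewrite -iterSr.
rewrite big_ord_recl /= subSS subn0 addrCA [leLHS]addrC.
by apply: lerD h1; exact: expect_offspring_square_le (m0 0%N) (xm 0%N).
Qed.

Variables (rho C g c : R).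
Hypotheses (rho2 : 2 <= rho) (g01 : 0 < g < 1) (c0 : 0 < c) (C0 : 0 < C).
Hypothesis hy : forall k t,
  `|y k.+1 t - rho * y k t| <= C * g ^+ k * rho ^+ k * alive_indicator t
  /\ c * rho ^+ k * alive_indicator t <= y k t <= C * rho ^+ k * alive_indicator t.

Let rho0 : 0 < rho. Proof. by move: rho2; lra. Qed.

Lemma expect_cluster_le k : s k <= C * rho ^+ k.
Proof.
rewrite /s (expect_type_sum p01 G1_dist p_fixed) /fresh_average /=.
have [_ /andP[_]] := hy k (true, (true, true)).
have [_ /andP[_]] := hy k (false, (true, true)).
rewrite !mulr1 -/N -/(y k) => h1 h2; case/andP: p01 => p0 p1; nra.
Qed.

(** The deviation of the one-step mean from exact growth at rate [rho] decays
    geometrically, relative to the growth, under the mean operator, and the fluctuations created at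
    each generation are of the order of the current population, hence the
    increments of the normalised cluster size decay geometrically. *)
Lemma increment_square_le : exists K th, [/\ 0 <= K, 0 < th < 1 & forall k,
  perc_expect p (fun W : {set edge (hgraph G1 k.+1)} =>
    (type_sum alive_indicator both W -
     rho * type_sum alive_indicator both (coarsen (fibres W))) ^+ 2)
  <= K * th ^+ k * (rho ^+ k) ^+ 2].
Proof.
have [g0 g1] := andP g01.
(* 3/4 ensures rho * th ^+ 2 >= 1, so that rho ^- k <= th ^+ (2 * k). *)
pose th := Num.max g (3 / 4).
have th1 : th < 1 by rewrite gt_max g1; lra.
have gth : g <= th by rewrite le_max lexx.
have th34 : 3 / 4 <= th by rewrite le_max lexx orbT.
have th0 : 0 < th by apply: lt_le_trans th34; lra.
have thk k : 0 <= th ^+ k by rewrite exprn_ge0 ?(ltW th0).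
have rk k : 0 < rho ^+ k by rewrite exprn_gt0.
have rth1 : 1 <= rho * th ^+ 2.
  have t2 : 1 / 2 <= th ^+ 2 by nra.
  by move: (th ^+ 2) t2 => u; have := rho2; nra.
have rth k : rho ^+ k <= (rho ^+ k) ^+ 2 * (th ^+ k) ^+ 2.
  have -> : (rho ^+ k) ^+ 2 * (th ^+ k) ^+ 2 = rho ^+ k * (rho * th ^+ 2) ^+ k.
    by rewrite exprMn [(th ^+ 2) ^+ k]exprAC; ring.
  by rewrite ler_peMr ?(ltW (rk k)) // exprn_ege1.
pose v t : R := 1 * N alive_indicator t + - rho * alive_indicator t.
have vm j t : `|iter j N v t| <= C * g ^+ j * rho ^+ j * alive_indicator t.
  have -> : iter j N v t = y j.+1 t - rho * y j t; last by case: (hy j t).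
  elim: j t => [|j IH] t; first by rewrite /= /v; ring.
  rewrite iterS (_ : iter j N v = fun t => 1 * y j.+1 t + - rho * y j t).
    by rewrite /N mean_linear mul1r mulNr.
  by apply/funext => u; rewrite IH; ring.
have m0 j : 0 <= C * g ^+ j * rho ^+ j.
  by rewrite !mulr_ge0 ?(ltW C0) ?(ltW (rk j)) ?exprn_ge0 ?(ltW g0).
have D0 : 0 <= D by exact: ler0n.
pose K1 := C ^+ 2 + D ^+ 2 * C ^+ 3 / (1 - th).
have Sv k : S k v <= K1 * th ^+ k * (rho ^+ k) ^+ 2.
  apply: le_trans (second_moment_bound k m0 vm) _.
  rewrite /K1 2!mulrDl; apply: lerD.
    have -> : (C * g ^+ k * rho ^+ k) ^+ 2 =
      C ^+ 2 * ((g ^+ k) ^+ 2 * (rho ^+ k) ^+ 2) by ring.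
    rewrite -[leRHS]mulrA ler_wpM2l ?exprn_ge0 ?(ltW C0) //.
    rewrite ler_wpM2r ?exprn_ge0 ?(ltW rho0) // expr2.
    apply: (@le_trans _ _ (g ^+ k)).
      by rewrite ler_piMr ?exprn_ile1 ?exprn_ge0 ?(ltW g0) ?(ltW g1).
    by rewrite lerXn2r ?nnegrE ?(ltW g0) ?(ltW th0).
  have tm j : (j < k)%N -> (C * g ^+ j * rho ^+ j * D) ^+ 2 * s (k - j.+1) <=
      D ^+ 2 * C ^+ 3 * th ^+ k * (rho ^+ k) ^+ 2 * th ^+ (k - j.+1).
    move=> jk; have [n kE] : exists n, k = (j + n.+1)%N.
      by exists (k - j.+1)%N; rewrite addnS -addSn subnKC.
    rewrite kE -addSnnS addKn.
    apply: (@le_trans _ _ ((C * g ^+ j * rho ^+ j * D) ^+ 2 * (C * rho ^+ n))).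
      by rewrite ler_wpM2l ?sqr_ge0 ?expect_cluster_le.
    have -> : (C * g ^+ j * rho ^+ j * D) ^+ 2 * (C * rho ^+ n) =
        D ^+ 2 * C ^+ 3 * (rho ^+ j) ^+ 2 * ((g ^+ j) ^+ 2 * rho ^+ n) by ring.
    have -> : D ^+ 2 * C ^+ 3 * th ^+ (j.+1 + n) * (rho ^+ (j.+1 + n)) ^+ 2 * th ^+ n =
        D ^+ 2 * C ^+ 3 * (rho ^+ j) ^+ 2 *
        (th ^+ j * ((rho ^+ n) ^+ 2 * (th ^+ n) ^+ 2 * (rho ^+ 2 * th))).
      by rewrite !exprD !exprS; ring.
    rewrite ler_wpM2l ?mulr_ge0 ?exprn_ge0 ?(ltW C0) ?(ltW rho0) //.
    apply: ler_pM; rewrite ?exprn_ge0 ?(ltW g0) ?(ltW rho0) //.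
      rewrite expr2; apply: (@le_trans _ _ (g ^+ j)).
        by rewrite ler_piMr ?exprn_ile1 ?exprn_ge0 ?(ltW g0) ?(ltW g1).
      by rewrite lerXn2r ?nnegrE ?(ltW g0) ?(ltW th0).
    apply: le_trans (rth n) _; apply: ler_peMr.
      by apply: mulr_ge0; exact: sqr_ge0.
    have r2 : 4 <= rho ^+ 2 by have := rho2; nra.
    by move: (rho ^+ 2) r2 => u; nra.
  apply: (@le_trans _ _ (\sum_(j < k) D ^+ 2 * C ^+ 3 * th ^+ k *
      (rho ^+ k) ^+ 2 * th ^+ (k - j.+1))).
    by apply: ler_sum => j _; exact: tm.
  rewrite -mulr_sumr.
  have -> : D ^+ 2 * C ^+ 3 / (1 - th) * th ^+ k * (rho ^+ k) ^+ 2 =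
     D ^+ 2 * C ^+ 3 * th ^+ k * (rho ^+ k) ^+ 2 * (1 - th)^-1 by ring.
  rewrite ler_wpM2l ?mulr_ge0 ?exprn_ge0 ?(ltW C0) ?(ltW th0) ?(ltW rho0) //.
  have th01 : 0 <= th < 1 by rewrite (ltW th0).
  apply: le_trans (sum_geometric_le k th01).
  by rewrite [leRHS](reindex_inj rev_ord_inj).
exists (K1 + D ^+ 2 * C), th; split; rewrite ?th0 ?th1 //.
  have : 0 <= (1 - th)^-1 by rewrite invr_ge0 subr_ge0 ltW.
  by rewrite /K1 => h; rewrite !addr_ge0 ?mulr_ge0 ?exprn_ge0 ?(ltW C0).
move=> k.
have := @expect_square_subst R p p01 G1 ra_neq_rb p_fixed (hgraph G1 k) alive_indicator
  (fun t => - rho * alive_indicator t) both.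
have -> : perc_expect p (fun W : {set edge (subst_graph (hgraph G1 k) G1)} =>
    (type_sum alive_indicator both W +
     type_sum (fun t => - rho * alive_indicator t) both (coarsen (fibres W))) ^+ 2) =
  perc_expect p (fun W : {set edge (hgraph G1 k.+1)} =>
    (type_sum alive_indicator both W -
     rho * type_sum alive_indicator both (coarsen (fibres W))) ^+ 2).
  apply: eq_bigr => W _; congr (_ * (_ + _) ^+ 2).
  by rewrite /type_sum -mulNr mulr_sumr.
have -> : perc_expect p (fun w : {set edge (hgraph G1 k)} =>
    type_sum (fun t => offspring_mean p G1 alive_indicator t + - rho * alive_indicator t) both w
      ^+ 2)
    = S k v.
  by apply: eq_bigr => w _; congr (_ * _ ^+ 2); apply: eq_bigr => e _;
    rewrite /v mul1r.
move=> h; apply: le_trans h _; rewrite 2!mulrDl; apply: lerD => //.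
have /= := @expect_offspring_square_le k alive_indicator 1 ler01.
rewrite mul1r => h; apply: le_trans (h _) _.
  by move=> t; rewrite mul1r ger0_norm // /alive_indicator ler0n.
have -> : D ^+ 2 * C * th ^+ k * (rho ^+ k) ^+ 2 =
  D ^+ 2 * (C * (th ^+ k * (rho ^+ k) ^+ 2)) by ring.
rewrite ler_wpM2l ?exprn_ge0 //.
apply: le_trans (expect_cluster_le k) _; rewrite ler_wpM2l ?(ltW C0) //.
apply: le_trans (rth k) _; rewrite mulrC ler_wpM2r ?sqr_ge0 //.
by rewrite expr2 ler_piMr ?exprn_ile1 ?(ltW th0) ?(ltW th1).
Qed.

Lemma increment_le : exists K eta, [/\ 0 <= K, 0 < eta < 1 & forall k,
  perc_expect p (fun W : {set edge (hgraph G1 k.+1)} =>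
    `|type_sum alive_indicator both W / rho ^+ k.+1 -
      type_sum alive_indicator both (coarsen (fibres W)) / rho ^+ k|)
  <= K * eta ^+ k].
Proof.
have [K [th [K0 /andP[th0 th1] h]]] := increment_square_le.
pose eta := Num.sqrt th.
have eta0 : 0 < eta by rewrite sqrtr_gt0.
have eta2 : eta ^+ 2 = th by rewrite sqr_sqrtr // ltW.
exists (K + 1), eta; split; first by rewrite addr_ge0.
  by rewrite eta0 -(expr_lt1 (n := 2)) ?eta2 // ltW.
move=> k; have ek : 0 < eta ^+ k by rewrite exprn_gt0.
have rk : 0 < rho ^+ k by rewrite exprn_gt0.
pose a := (eta ^+ k * (rho ^+ k) ^+ 2)^-1.
have a0 : 0 < a by rewrite invr_gt0 mulr_gt0 // exprn_gt0.
(* Instead of the Cauchy-Schwarz inequality, bound |d| by d^2/eta^k + eta^k. *)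
apply: (@le_trans _ _ (perc_expect p (fun W : {set edge (hgraph G1 k.+1)} =>
    a * (type_sum alive_indicator both W -
     rho * type_sum alive_indicator both (coarsen (fibres W))) ^+ 2 + eta ^+ k))).
  apply: ler_perc_expect => // W.
  move: (type_sum _ _ (coarsen _)) (type_sum _ _ W) => Y X.
  have -> : X / rho ^+ k.+1 - Y / rho ^+ k = (X - rho * Y) / rho ^+ k / rho.
    by rewrite exprS; field; rewrite !gt_eqF.
  set d := (X - rho * Y) / rho ^+ k.
  have -> : a * (X - rho * Y) ^+ 2 = d ^+ 2 / eta ^+ k.
    by rewrite /a /d; field; rewrite !gt_eqF.
  apply: (@le_trans _ _ `|d|).
    rewrite normrM normfV ler_piMr // (gtr0_norm rho0) invf_le1 //.
    by have := rho2; lra.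
  rewrite -(ler_pM2r ek) mulrDl divfK ?gt_eqF // -[d ^+ 2]real_normK ?num_real //.
  have : 0 <= `|d| by []. nra.
rewrite perc_expectD perc_expect_cst // perc_expectZ mulrDl mul1r lerD2r.
apply: le_trans (ler_wpM2l (ltW a0) (h k)) _; rewrite -eta2 [(eta ^+ 2) ^+ k]exprAC.
rewrite le_eqVlt; apply/orP; left; apply/eqP; rewrite /a; field.
by rewrite !gt_eqF.
Qed.

End SecondMoment.

(** * Generating functions and small values *)

(** The first two Bonferroni inequalities, the second in a weak form. *)
Lemma prod_1subr_bounds (R : realDomainType) (I : Type) (r : seq I) (x : I -> R) :
  (forall i, 0 <= x i <= 1) ->
  let S := \sum_(i <- r) x i in
  1 - S <= \prod_(i <- r) (1 - x i) <= 1 - S + S ^+ 2.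
Proof.
move=> x01; elim: r => [|i r] /=; first by rewrite !big_nil; lra.
rewrite !big_cons; have S0 : 0 <= \sum_(j <- r) x j.
  by apply: sumr_ge0 => j _; case/andP: (x01 j).
have /andP[xi0 xi1] := x01 i.
set S := \sum_(j <- r) x j in S0 *; move: (\prod_(j <- r) _) => P /andP[h1 h2].
by apply/andP; split; nra.
Qed.

Section GeneratingFunction.
Variables (R : realType) (p : R) (G1 : ograph).
Hypothesis p01 : 0 < p < 1.
Hypothesis G1_dist : (1 < gdist (ra G1) (rb G1))%N.
Hypothesis G1_paths : two_edge_disjoint_paths (ra G1) (rb G1).
Hypothesis p_fixed : cross_prob G1 p = p.

Let N := offspring_mean p G1.
Let f := genfun p G1.
Let D : R := #|edge G1|%:R.
Let y k := iter k N alive_indicator.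
Let both := (true, true).
Let ra_neq_rb := dist_gt1_neq G1_dist.

Lemma expect_prod k s :
  perc_expect (G := hgraph G1 k) p (fun w => \prod_e s (status both w e)) =
  fresh_average p (iter k f s) both.
Proof.
elim: k s => [|k IH] s.
  have prodE (w : {set edge single_edge}) :
      \prod_e s (status both w e) = s (tt \in w, (true, true)).
    rewrite (big_pred1 tt); last by case.
    by rewrite /status /reached /= !linked_refl orbT.
  by rewrite perc_expect_single !prodE !inE.
by rewrite expect_prod_subst // IH iterSr.
Qed.

Lemma genfun_ge0 s : (forall t, 0 <= s t) -> forall t, 0 <= f s t.
Proof.
move=> s0 t; apply: sumr_ge0 => u _; rewrite mulr_ge0 ?cond_weight_ge0 //.
by apply: prodr_ge0.
Qed.

Lemma genfun_le s t m :
  (forall u : {set edge G1}, \prod_e s (status t.2 u e) <= m) -> f s t <= m.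
Proof.
move=> h; rewrite -[leRHS]mul1r -(sum_cond_weight p01 p_fixed t.1) mulr_suml.
by apply: ler_sum => u _; rewrite ler_wpM2l ?cond_weight_ge0.
Qed.

Lemma genfun_le1 s : (forall t, 0 <= s t <= 1) -> forall t, 0 <= f s t <= 1.
Proof.
move=> s01 t; rewrite genfun_ge0 /=; last by move=> t'; case/andP: (s01 t').
apply: genfun_le => u.
by apply: prodr_ile1 => e _; exact: s01.
Qed.

Lemma iter_genfun_le1 k s : (forall t, 0 <= s t <= 1) ->
  forall t, 0 <= iter k f s t <= 1.
Proof. by move=> s01; elim: k => [//|k IH]; exact: genfun_le1. Qed.

(** Having two reached descendants squares every bound below one. *)
Lemma genfun_square s q : (forall t, 0 <= s t <= 1) ->
  (forall t, alive t -> s t <= q) -> forall t, alive t -> f s t <= q ^+ 2.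
Proof.
move=> s01 sq t tal; apply: genfun_le => u.
have [e1 [e2 [e12 h1 h2]]] := two_children G1_dist G1_paths u tal.
rewrite (bigD1 e1) //= (bigD1 e2) 1?eq_sym //= mulrA.
have s0 t' : 0 <= s t' by case/andP: (s01 t').
have r1 : \prod_(i | (i != e1) && (i != e2)) s (status t.2 u i) <= 1.
  by apply: prodr_ile1 => e _; exact: s01.
apply: (@le_trans _ _ (s (status t.2 u e1) * s (status t.2 u e2))).
  by rewrite ler_piMr // mulr_ge0.
by rewrite expr2; apply: ler_pM; rewrite ?sq.
Qed.

Lemma iter_genfun_square m s q : (forall t, 0 <= s t <= 1) ->
  (forall t, alive t -> s t <= q) ->
  forall t, alive t -> iter m f s t <= q ^+ (2 ^ m).
Proof.
move=> s01 sq; elim: m => [|m IH] t tal; first by rewrite expn0 expr1 sq.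
rewrite iterS expnSr exprM; apply: genfun_square => //.
exact: iter_genfun_le1.
Qed.

(** Linearisation at one, with an error quadratic in the distance to one. *)
Lemma genfun_expansion x m t : 0 <= m ->
  (forall t, 0 <= x t <= 1) -> (forall t, x t <= m * alive_indicator t) ->
  N x t - (m * D) ^+ 2 * alive_indicator t <= 1 - f (fun t => 1 - x t) t <= N x t.
Proof.
move=> m0 x01 xm.
have xm' t' : `|x t'| <= m * alive_indicator t'.
  by rewrite ger0_norm //; case/andP: (x01 t').
have e1 : 1 - f (fun t => 1 - x t) t =
    \sum_u cond_weight p t.1 u * (1 - \prod_(e : edge G1) (1 - x (status t.2 u e))).
  under [RHS]eq_bigr do rewrite mulrBr mulr1.
  by rewrite sumrB (sum_cond_weight p01 p_fixed).
have e2 : N x t - (m * D) ^+ 2 * alive_indicator t =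
    \sum_(u : {set edge G1}) cond_weight p t.1 u *
      (type_sum x t.2 u - (m * D) ^+ 2 * alive_indicator t).
  under [RHS]eq_bigr do rewrite mulrBr.
  by rewrite sumrB -mulr_suml (sum_cond_weight p01 p_fixed) mul1r.
rewrite e2 e1; apply/andP; split; apply: ler_sum => u _;
  rewrite ler_wpM2l ?cond_weight_ge0 //;
  have /andP[h1 h2] := prod_1subr_bounds (index_enum (edge G1))
    (fun e => x01 (status t.2 u e)); rewrite /type_sum.
  have := type_sum_sqr_le t.2 u m0 xm'.
  by rewrite -/D -[(_ || _)%:R]/(alive_indicator t) /type_sum; lra.
by lra.
Qed.

Variables (rho C g c : R).
Hypotheses (rho2 : 2 <= rho) (c0 : 0 < c) (C0 : 0 < C).
Hypothesis hy : forall k t,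
  `|y k.+1 t - rho * y k t| <= C * g ^+ k * rho ^+ k * alive_indicator t
  /\ c * rho ^+ k * alive_indicator t <= y k t <= C * rho ^+ k * alive_indicator t.

Let rho0 : 0 < rho. Proof. by move: rho2; lra. Qed.

(** The quadratic error made at step [i], of order [(rho ^+ i) ^+ 2], is carried
    along by the mean operator. *)
Fixpoint error_term j : etype -> R :=
  if j is i.+1 then fun t => 1 * N (error_term i) t + (rho ^+ i) ^+ 2 * alive_indicator t
  else fun=> 0.

(** The errors grow like $\rho^{2j}$, faster than they are amplified by the mean
    operator, so that the latest dominate; the induction uses $\rho + 1 \le \rho^2$. *)
Lemma error_term_le j n t :
  iter n N (error_term j) t <= C * rho ^+ n * (rho ^+ j) ^+ 2 * alive_indicator t.
Proof.
have linear n' a b x z : iter n' N (fun t => a * x t + b * z t) =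
    fun t => a * iter n' N x t + b * iter n' N z t.
  elim: n' => [//|n' IH]; rewrite iterS IH; apply/funext => t'.
  exact: mean_linear.
have a0 : 0 <= alive_indicator t :> R by exact: ler0n.
elim: j n t a0 => [|j IH] n t a0.
  have -> : iter n N (error_term 0) t = 0.
    have := linear n 0 0 (fun=> 0) (fun=> 0).
    rewrite (_ : (fun _ => _) = error_term 0).
      by move=> ->; rewrite !mul0r addr0.
    by apply/funext => t'; rewrite !mul0r addr0.
  by rewrite !mulr_ge0 ?exprn_ge0 ?(ltW C0) ?(ltW rho0).
rewrite /= linear mul1r -iterSr.
apply: (@le_trans _ _ (C * rho ^+ n.+1 * (rho ^+ j) ^+ 2 * alive_indicator t +
   (rho ^+ j) ^+ 2 * (C * rho ^+ n * alive_indicator t))).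
  apply: lerD; first exact: IH.
  by rewrite ler_wpM2l ?sqr_ge0 //; have [_ /andP[]] := hy n t.
rewrite [rho ^+ n.+1]exprS [rho ^+ j.+1]exprS.
have -> : C * (rho * rho ^+ n) * (rho ^+ j) ^+ 2 * alive_indicator t +
  (rho ^+ j) ^+ 2 * (C * rho ^+ n * alive_indicator t) =
  C * rho ^+ n * (rho ^+ j) ^+ 2 * alive_indicator t * (rho + 1) by ring.
have -> : C * rho ^+ n * (rho * rho ^+ j) ^+ 2 * alive_indicator t =
  C * rho ^+ n * (rho ^+ j) ^+ 2 * alive_indicator t * rho ^+ 2 by ring.
rewrite ler_wpM2l //; last by have := rho2; nra.
by rewrite !mulr_ge0 ?exprn_ge0 ?(ltW C0) ?(ltW rho0).
Qed.

(** Since generating functions are convex the iterates follow the linearised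
    recursion from one side; from the other, the error is of second order as long
    as the linearised solution is small. *)
Lemma iter_genfun_expansion t0 j t : 0 <= t0 <= 1 ->
  t0 * y j t - (C * D * t0) ^+ 2 * error_term j t <=
  1 - iter j f (fun t => 1 - t0 * alive_indicator t) t <= t0 * y j t.
Proof.
move=> /andP[t00 t01].
have s01 t' : 0 <= 1 - t0 * alive_indicator t' <= 1.
  by rewrite /alive_indicator; case: (alive t') => /=; lra.
pose x i t := 1 - iter i f (fun t => 1 - t0 * alive_indicator t) t.
rewrite -/(x j t); elim: j t => [|j IH] t.
  by rewrite /x /y /=; apply/andP; split; lra.
have x01 t' : 0 <= x j t' <= 1.
  by have := iter_genfun_le1 j s01 t'; rewrite /x; lra.
pose m := t0 * (C * rho ^+ j).
have m0 : 0 <= m by rewrite !mulr_ge0 ?exprn_ge0 ?(ltW C0) ?(ltW rho0).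
have xm t' : x j t' <= m * alive_indicator t'.
  case/andP: (IH t') => _ h; apply: le_trans h _; rewrite /m -mulrA ler_wpM2l //.
  by have [_ /andP[]] := hy j t'.
have := genfun_expansion t m0 x01 xm.
have -> : f (fun t => 1 - x j t) = iter j.+1 f (fun t => 1 - t0 * alive_indicator t).
  by rewrite iterS; congr f; apply/funext => t'; rewrite /x opprB addrC subrK.
rewrite -/(x j.+1 t) => /andP[h1 h2].
have NE : N (fun t => t0 * y j t + - (C * D * t0) ^+ 2 * error_term j t) t =
    t0 * y j.+1 t + - (C * D * t0) ^+ 2 * N (error_term j) t.
  exact: mean_linear.
apply/andP; split; last first.
  apply: le_trans h2 _.
  apply: (positive_operator_upper (@mean_linear R p G1) (mean_ge0 G1 p01)) => t'.
  by case/andP: (IH t').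
apply: le_trans h1.
have : N (fun t => t0 * y j t + - (C * D * t0) ^+ 2 * error_term j t) t <= N (x j) t.
  rewrite -[leLHS]mul1r.
  apply: (positive_operator_lower (@mean_linear R p G1) (mean_ge0 G1 p01)) => t'.
  by rewrite mul1r mulNr; case/andP: (IH t').
rewrite NE /= mul1r /m.
have -> : (t0 * (C * rho ^+ j) * D) ^+ 2 = (C * D * t0) ^+ 2 * (rho ^+ j) ^+ 2 by ring.
by move: (N _ t) (N _ t) => a b; lra.
Qed.

(** Starting at distance $\tau\rho^{-n}$ from one, the linear term after [n]
    steps is at least $c\tau$ and the error at most a multiple of $\tau^2$, so a
    small $\tau$ leaves a definite distance. *)
Lemma genfun_bounded_away : exists eta kappa, [/\ 0 < eta <= 1, 0 < kappa <= 1 &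
  forall n t0, eta / 2 <= t0 * rho ^+ n <= eta -> forall t, alive t ->
  iter n f (fun t => 1 - t0 * alive_indicator t) t <= 1 - kappa].
Proof.
pose B := C ^+ 3 * D ^+ 2 + 1.
have B1 : 1 <= B by rewrite lerDr mulr_ge0 ?exprn_ge0 ?ler0n ?(ltW C0).
pose eta := Num.min 1 (c / (2 * B)).
have eta0 : 0 < eta by rewrite lt_min ltr01 divr_gt0 //; lra.
have eta1 : eta <= 1 by rewrite ge_min lexx.
have etaB : B * eta <= c / 2.
  apply: (@le_trans _ _ (B * (c / (2 * B)))).
    by rewrite ler_wpM2l ?ge_min ?lexx ?orbT //; lra.
  by rewrite le_eqVlt; apply/orP; left; apply/eqP; field; rewrite gt_eqF //; lra.
have key n t0 t : eta / 2 <= t0 * rho ^+ n <= eta -> alive t ->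
    eta * c / 4 <= 1 - iter n f (fun t => 1 - t0 * alive_indicator t) t.
  move=> /andP[l1 l2] tal.
  have rn : 1 <= rho ^+ n by rewrite exprn_ege1 //; have := rho2; lra.
  have t00 : 0 <= t0.
    by rewrite -(pmulr_lge0 _ (lt_le_trans ltr01 rn)); apply: le_trans l1; lra.
  have t01 : t0 <= 1.
    by apply: le_trans eta1; apply: le_trans l2; rewrite ler_peMr.
  have t001 : 0 <= t0 <= 1 by rewrite t00.
  have /andP[h _] := iter_genfun_expansion n t t001.
  apply: le_trans h.
  have := error_term_le n 0 t; rewrite /= expr0 mulr1 {1}/alive_indicator tal mulr1 => h3.
  have [_ /andP[+ _]] := hy n t; rewrite {1}/alive_indicator tal mulr1 => h4.
  set tau := t0 * rho ^+ n in l1 l2.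
  have h5 : c * tau <= t0 * y n t.
    apply: le_trans (ler_wpM2l t00 h4).
    by rewrite /tau le_eqVlt; apply/orP; left; apply/eqP; ring.
  have h6 : (C * D * t0) ^+ 2 * error_term n t <= B * tau ^+ 2.
    apply: (@le_trans _ _ ((C * D * t0) ^+ 2 * (C * (rho ^+ n) ^+ 2))).
      by rewrite ler_wpM2l ?sqr_ge0.
    have -> : (C * D * t0) ^+ 2 * (C * (rho ^+ n) ^+ 2) =
      C ^+ 3 * D ^+ 2 * tau ^+ 2 by rewrite /tau; ring.
    by rewrite ler_wpM2r ?sqr_ge0 // lerDl.
  have h7 : B * tau ^+ 2 <= tau * (c / 2).
    rewrite expr2 mulrCA ler_wpM2l //; first by lra.
    by apply: le_trans etaB; rewrite ler_wpM2l //; lra.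
  have := ler_wpM2r (ltW c0) l1; lra.
exists eta, (eta * c / 4); rewrite eta0 eta1; split => // [|n t0 h t tal].
  rewrite divr_gt0 ?mulr_gt0 //=.
  have := @key 0%N eta (true, both); rewrite expr0 mulr1 lexx andbT => h.
  apply: le_trans (h _ isT) _; first by lra.
  by rewrite /= /alive_indicator mulr1; lra.
by have := key n t0 t h tal; lra.
Qed.

(** The Laplace transforms of the normalised cluster sizes are small at large
    arguments, uniformly in the generation: over the first steps the iterates of
    the generating function leave the neighbourhood of one, by its expansion
    there, and each of the last [m] steps squares them. *)
Lemma laplace_small : exists eta q, [/\ 0 < eta, 0 <= q < 1 & forall m k,
  (m <= k)%N -> perc_expect (G := hgraph G1 k) p (fun w =>
    expR (- (eta * rho ^+ m * (type_sum alive_indicator both w / rho ^+ k)))) <= q ^+ m].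
Proof.
have [eta [kappa [/andP[eta0 eta1] /andP[kap0 kap1] h]]] := genfun_bounded_away.
exists eta, (1 - kappa); split=> // [|m k mk].
  by apply/andP; split; lra.
have q0 : 0 <= 1 - kappa by lra.
have q1 : 1 - kappa <= 1 by lra.
pose n := (k - m)%N; have kE : k = (m + n)%N by rewrite subnKC.
have rj j : 0 < rho ^+ j by rewrite exprn_gt0.
pose z := eta / rho ^+ n; pose t0 := 1 - expR (- z).
have z0 : 0 < z by rewrite divr_gt0.
have z1 : z <= 1.
  rewrite ler_pdivrMr // mul1r; apply: le_trans eta1 _; rewrite exprn_ege1 //.
  by have := rho2; lra.
have t0z : t0 <= z by have := expR_ge1Dx (- z); rewrite /t0; lra.
have zt0 : z / 2 <= t0.
  have ez : 1 + z <= expR z by exact: expR_ge1Dx.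
  have -> : t0 = 1 - (expR z)^-1 by rewrite /t0 expRN.
  have : (expR z)^-1 <= (1 + z)^-1 by rewrite lef_pV2 ?posrE ?expR_gt0 //; lra.
  have : (1 + z)^-1 <= 1 - z / 2.
    by rewrite -[(1 + z)^-1]mul1r ler_pdivrMr; [nra | lra].
  lra.
have t0rho : eta / 2 <= t0 * rho ^+ n <= eta.
  have zr : z * rho ^+ n = eta by rewrite divfK // gt_eqF.
  by rewrite -zr; apply/andP; split; have := rj n; nra.
have -> : perc_expect (G := hgraph G1 k) p (fun w =>
    expR (- (eta * rho ^+ m * (type_sum alive_indicator both w / rho ^+ k)))) =
  perc_expect (G := hgraph G1 k) p (fun w =>
    \prod_e (fun t => 1 - t0 * alive_indicator t) (status both w e)).
  apply: eq_bigr => w _; congr (_ * _).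
  have -> : eta * rho ^+ m * (type_sum alive_indicator both w / rho ^+ k) =
      z * type_sum alive_indicator both w.
    by rewrite /z [in rho ^+ k]kE exprD; field; rewrite !gt_eqF.
  rewrite /type_sum mulr_sumr -sumrN expR_sum; apply: eq_bigr => e _.
  rewrite /alive_indicator /t0; case: (alive _).
    by rewrite !mulr1 opprB addrC subrK.
  by rewrite !mulr0 oppr0 expR0 addr0.
rewrite (expect_prod k (fun t => 1 - t0 * alive_indicator t)) kE iterD.
have s01 t' : 0 <= 1 - t0 * alive_indicator t' <= 1.
  by rewrite /alive_indicator; case: (alive t') => /=; lra.
have b t : alive t ->
    iter m f (iter n f (fun t => 1 - t0 * alive_indicator t)) t <= (1 - kappa) ^+ m.
  move=> tal; have sn := iter_genfun_square m (iter_genfun_le1 n s01).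
  apply: le_trans (sn _ (h _ _ t0rho) _ tal) _.
  by apply: ler_wiXn2l => //; rewrite ltnW // ltn_expl.
have := b (true, both) isT; have := b (false, both) isT.
by rewrite /fresh_average /=; case/andP: p01 => p0 p1; nra.
Qed.

End GeneratingFunction.

Local Open Scope classical_set_scope.
Local Open Scope ring_scope.

(** * Limits along a tower of finite probability spaces *)

Section Offset.
Variables (R : realType) (T : eqType) (w : T -> R).

(** Position of [t] when consecutive intervals of lengths [w] are laid end to end
    in the order of [s]. *)
Definition offset (s : seq T) t : R := \sum_(u <- take (index t s) s) w u.

Lemma offset_cons a s t : t != a -> offset (a :: s) t = w a + offset s t.
Proof. by rewrite /offset /= eq_sym => /negbTE -> /=; rewrite big_cons. Qed.

Lemma telescoping_offset (st : R -> R) s l : uniq s ->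
  \sum_(t <- s) (st (l + offset s t + w t) - st (l + offset s t)) =
  st (l + \sum_(t <- s) w t) - st l.
Proof.
elim: s l => [|a s IH] l; first by rewrite !big_nil addr0 subrr.
move=> /= /andP[as_ us]; rewrite !big_cons.
have -> : offset (a :: s) a = 0 by rewrite /offset /= eqxx big_nil.
rewrite addr0 addrA.
transitivity (st (l + w a) - st l + \sum_(t <- s)
    (st (l + w a + offset s t + w t) - st (l + w a + offset s t))).
  congr (_ + _); apply: eq_big_seq => t ts.
  by rewrite offset_cons ?addrA //; apply: contraNneq as_ => <-.
by rewrite IH // [LHS]addrC addrA subrK.
Qed.

Lemma offset_bounds s t : (forall u, 0 <= w u) -> t \in s ->
  0 <= offset s t /\ offset s t + w t <= \sum_(u <- s) w u.
Proof.
move=> w0; elim: s => [//|a s IH].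
have [-> _|ta] := eqVneq t a.
  rewrite /offset /= eqxx big_nil big_cons lexx add0r lerDl; split => //.
  by apply: sumr_ge0.
rewrite inE (negbTE ta) /= => /IH[h1 h2]; rewrite offset_cons // big_cons.
by split; [rewrite addr_ge0 | rewrite -addrA lerD2l].
Qed.

End Offset.

Section Tower.
Variables (R : realType) (Om : nat -> finType) (P : forall k, Om k -> R).
Variable proj : forall k, Om k.+1 -> Om k.
Hypothesis P_ge0 : forall k (w : Om k), 0 <= P w.
Hypothesis P_total : \sum_(w : Om 0%N) P w = 1.
Hypothesis P_proj : forall k (w : Om k), \sum_(v | proj v == w) P v = P w.

(** The interval of a point is subdivided among the points above it. *)
Fixpoint left_end k : Om k -> R :=
  match k with
  | 0%N => fun w => 0 + offset (@P 0%N) (enum (Om 0%N)) w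
  | k'.+1 => fun w => left_end (proj w) +
      offset (@P k'.+1) (enum [pred v | proj v == proj w]) w
  end.

Definition cell k (w : Om k) : set R :=
  `[left_end w, left_end w + P w[%classic.

Let below (x a : R) : R := (x < a)%R%:R.

(** In this form the partition of a cell into the cells above it is a
    telescoping sum. *)
Lemma cell_indic k (w : Om k) x :
  \1_(cell w) x = below x (left_end w + P w) - below x (left_end w) :> R.
Proof.
rewrite indicE /cell mem_setE in_itv /= /below.
have := P_ge0 w; case: (ltP x (left_end w)) => h; case: (ltP x (left_end w + P w));
  rewrite /= ?subrr ?subr0 //; lra.
Qed.

Lemma cell_split k (w : Om k) x :
  \1_(cell w) x = \sum_(v | proj v == w) \1_(cell v) x :> R.
Proof.
rewrite cell_indic.
have := telescoping_offset (@P k.+1) (below x) (left_end w)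
  (enum_uniq [pred v | proj v == w]).
rewrite !big_enum /= => h.
rewrite -P_proj -h; apply: eq_bigr => v /eqP vw.
by rewrite cell_indic /= vw.
Qed.

Lemma cell_cover k x : \sum_(w : Om k) \1_(cell w) x = \1_(`[0, 1[ : set R) x :> R.
Proof.
elim: k => [|k IH]; last first.
  by rewrite -IH (partition_big (@proj k) xpredT) //=;
    apply: eq_bigr => w _; rewrite cell_split.
have := telescoping_offset (@P 0%N) (below x) 0 (enum_uniq (Om 0%N)).
rewrite !big_enum /= P_total add0r => h.
transitivity (below x 1 - below x 0); last first.
  rewrite indicE mem_setE in_itv /= /below.
  by case: (ltP x 0) => h1; case: (ltP x 1) => h2;
    rewrite /= ?subrr ?subr0 //; lra.
by rewrite -h; apply: eq_bigr => w _; rewrite cell_indic.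
Qed.

Lemma cell_bounds k (w : Om k) : 0 <= left_end w /\ left_end w + P w <= 1.
Proof.
elim: k w => [|k IH] w.
  have [|h1 h2] := @offset_bounds R _ (@P 0%N) (enum (Om 0%N)) w (@P_ge0 0%N).
    by rewrite mem_enum.
  by rewrite /= add0r; split => //; apply: le_trans h2 _; rewrite big_enum /= P_total.
have [|h1 h2] := @offset_bounds R _ (@P k.+1) (enum [pred v | proj v == proj w]) w
  (@P_ge0 k.+1).
  by rewrite mem_enum inE.
have [h3 h4] := IH (proj w); rewrite /=; split; first by rewrite addr_ge0.
apply: le_trans h4; rewrite -addrA lerD2l; apply: le_trans h2 _.
by rewrite big_enum /= P_proj.
Qed.

Let U : probability _ R := uniform_prob (@ltr01 R).

Lemma cell_measurable k (w : Om k) : measurable (cell w).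
Proof. exact: measurable_itv. Qed.

Lemma integral_cell k (w : Om k) : (\int[U]_x (\1_(cell w) x)%:E = (P w)%:E)%E.
Proof.
rewrite integral_uniform; last 2 first.
- by apply/measurable_EFinP; apply: measurable_indic; exact: cell_measurable.
- by move=> x; rewrite lee_fin.
rewrite subr0 invr1 mul1e integral_indic //; last exact: cell_measurable.
have [h1 h2] := cell_bounds w.
rewrite (_ : _ `&` _ = cell w); last first.
  apply/seteqP; split => x; first by case.
  rewrite /cell /= !in_itv /= => /andP[h3 h4]; split; first by rewrite h3.
  by apply/andP; split; lra.
rewrite /cell /= lebesgue_measure_itv /= lte_fin ltrDl.
have := P_ge0 w; rewrite le_eqVlt => /orP[/eqP <-|->]; first by rewrite ltxx.
by rewrite -EFinB addrAC subrr add0r.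
Qed.

(** The random variable [a] transported to the unit interval; it vanishes outside
    all cells. *)
Definition lift_rv k (a : Om k -> R) x : R := \sum_w a w * \1_(cell w) x.

Lemma lift_rv_measurable k (a : Om k -> R) : measurable_fun setT (lift_rv a).
Proof.
apply: measurable_sum => w; apply: measurable_funM; first exact: measurable_cst.
by apply: measurable_indic; exact: cell_measurable.
Qed.

Lemma lift_rv_integrable k (a : Om k -> R) :
  U.-integrable setT (EFin \o lift_rv a).
Proof.
rewrite (_ : _ \o _ = fun x => (\sum_w (a w * \1_(cell w) x)%:E)%E); last first.
  by apply/funext => x; rewrite /= /lift_rv -sumEFin.
apply: integrable_sum => // w _; under eq_fun do rewrite EFinM.
by apply: integrableZl => //; apply: integrable_indic; exact: cell_measurable.
Qed.

Lemma integral_lift_rv k (a : Om k -> R) :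
  (\int[U]_x (lift_rv a x)%:E = (\sum_w P w * a w)%:E)%E.
Proof.
under eq_integral do rewrite /lift_rv -sumEFin.
rewrite integral_sum //; last first.
  move=> w; under eq_fun do rewrite EFinM.
  apply: integrableZl => //; apply: integrable_indic; exact: cell_measurable.
rewrite -sumEFin; apply: eq_bigr => w _.
under eq_integral do rewrite EFinM.
rewrite integralZl //; last by apply: integrable_indic; exact: cell_measurable.
by rewrite integral_cell -EFinM mulrC.
Qed.

(** At a given point at most one cell contributes. *)
Lemma comp_lift_rv k (a : Om k -> R) (h : R -> R) x :
  h (lift_rv a x) = h 0 + lift_rv (fun w => h (a w) - h 0) x.
Proof.
rewrite /lift_rv; have := cell_cover k x.
have i01 (w : Om k) : \1_(cell w) x = 0 :> R \/ \1_(cell w) x = 1 :> R.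
  by rewrite !indicE; case: (x \in _); [right|left].
have [/existsP[w /eqP xw] xc|/existsPn noc _] :=
    boolP [exists w : Om k, \1_(cell w) x == 1 :> R].
  have rest : forall v : Om k, v != w -> \1_(cell v) x = 0 :> R.
    move=> v vw; have [//|xv] := i01 v.
    have : 1 + 1 <= \sum_(v : Om k) \1_(cell v) x :> R.
      rewrite (bigD1 w) //= (bigD1 v) //= xw xv addrA lerDl.
      by apply: sumr_ge0 => u _; rewrite indicE.
    rewrite xc indicE; case: (_ \in _) => /=; lra.
  rewrite (bigD1 w) //= [X in h (_ + X)]big1; last first.
    by move=> v /rest ->; rewrite mulr0.
  rewrite [in RHS](bigD1 w) //= [X in _ + (_ + X)]big1; last first.
    by move=> v /rest ->; rewrite mulr0.
  by rewrite xw !mulr1 !addr0 addrC subrK.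
have z (w : Om k) : \1_(cell w) x = 0 :> R.
  by have [//|e] := i01 w; have := noc w; rewrite e eqxx.
by rewrite !big1 ?addr0 // => w _; rewrite z mulr0.
Qed.

Lemma integral_comp_lift_rv k (a : Om k -> R) (h : R -> R) :
  (\int[U]_x (h (lift_rv a x))%:E = (\sum_w P w * h (a w))%:E)%E.
Proof.
have total : forall j, \sum_(w : Om j) P w = 1.
  elim=> [//|j IH]; rewrite (partition_big (@proj j) xpredT) //= -IH.
  by apply: eq_bigr => w _; rewrite P_proj.
under eq_integral do rewrite comp_lift_rv.
have -> : (fun x => (h 0 + lift_rv (fun w => h (a w) - h 0) x)%:E) =
    (fun x => (cst (h 0)%:E x + (lift_rv (fun w => h (a w) - h 0) x)%:E)%E).
  by apply/funext => x; rewrite EFinD.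
have int_lift : U.-integrable setT (EFin \o lift_rv (fun w => h (a w) - h 0)).
  exact: lift_rv_integrable.
rewrite integralD //; last first.
  by apply: finite_measure_integrable_cst.
rewrite integral_cst //.
rewrite [X in (_ * X + _)%E](_ : _ = 1%E); last exact: probability_setT.
rewrite mule1 integral_lift_rv -EFinD.
congr EFin; under eq_bigr do rewrite mulrBr.
by rewrite sumrB -mulr_suml total mul1r addrC subrK.
Qed.

(** A tower of finite probability spaces is realised on the unit interval by
    nested partitions into intervals; there the random variables converge almost
    everywhere because their increments are summable in mean, and the law of
    the limit is the weak limit of their laws. *)
Lemma tower_limit (Y : forall k, Om k -> R) (K eta : R) :
  0 <= K -> 0 < eta < 1 ->
  (forall k, \sum_(v : Om k.+1) P v * `|Y k.+1 v - Y k (proj v)| <= K * eta ^+ k) ->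
  exists mu : probability (measurableTypeR R) R, forall h : R -> R,
    continuous h -> (exists B : R, forall x, `|h x| <= B) ->
    \sum_(w : Om k) P w * h (Y k w) @[k --> \oo] --> \int[mu]_x h x.
Proof.
move=> K0 /andP[eta0 eta1] hY.
pose X k := lift_rv (Y k).
pose d k := lift_rv (fun v => Y k.+1 v - Y k (proj v)).
pose b k := lift_rv (fun v => `|Y k.+1 v - Y k (proj v)|).
have dE k x : X k.+1 x - X k x = d k x.
  have XE : X k x = \sum_(v : Om k.+1) Y k (proj v) * \1_(cell v) x.
    rewrite (partition_big (@proj k) xpredT) //=; apply: eq_bigr => w _.
    by rewrite cell_split mulr_sumr; apply: eq_bigr => v /eqP ->.
  by rewrite XE -sumrB; apply: eq_bigr => v _; rewrite mulrBl.
have i0 k (w : Om k) x : 0 <= \1_(cell w) x :> R by rewrite indicE.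
have b0 k x : 0 <= b k x by apply: sumr_ge0 => v _; rewrite mulr_ge0.
have db k x : `|d k x| <= b k x.
  apply: le_trans (ler_norm_sum _ _ _) _; apply: ler_sum => v _.
  by rewrite normrM (ger0_norm (i0 _ _ _)).
have mb k : measurable_fun setT (fun x => (b k x)%:E).
  by apply/measurable_EFinP; exact: lift_rv_measurable.
pose S x := (\sum_(k <oo) (b k x)%:E)%E.
have S0 x : (0 <= S x)%E by apply: nneseries_ge0 => k _ _; rewrite lee_fin.
have mS : measurable_fun setT S.
  by apply: ge0_emeasurable_sum => // k x _ _; rewrite lee_fin.
have intS : (\int[U]_x S x < +oo)%E.
  rewrite integral_nneseries //; last by move=> k x _; rewrite lee_fin.
  apply: (@le_lt_trans _ _ (K * (1 - eta)^-1)%:E); last exact: ltry.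
  apply: lime_le.
    apply: is_cvg_nneseries => k _ _; apply: integral_ge0 => x _.
    by rewrite lee_fin.
  apply: nearW => n; rewrite /b.
  under eq_bigr do rewrite integral_lift_rv.
  rewrite sumEFin lee_fin big_mkord.
  apply: (@le_trans _ _ (\sum_(i < n) K * eta ^+ i)); first exact: ler_sum.
  rewrite -mulr_sumr ler_wpM2l //; apply: sum_geometric_le.
  by rewrite (ltW eta0).
have [M [mM UM0 SM]] : {ae U, forall x, setT x -> S x \is a fin_num}.
  apply: integrable_ae => //; apply/integrableP; split => //.
  by under eq_integral do rewrite gee0_abs //.
have X_cvg x : ~ M x -> cvgn (X ^~ x).
  move=> xM; have Sx : S x \is a fin_num.
    by apply: contrapT => nS; apply: xM; apply: SM => /= h; apply: nS; exact: h.
  have -> : X ^~ x = (fun n => X 0%N x + series (d ^~ x) n).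
    apply/funext => n; rewrite seriesEord /=; elim: n => [|n IH].
      by rewrite big_ord0 addr0.
    by rewrite big_ord_recr /= addrA -IH -dE addrC subrK.
  apply: is_cvgD; first exact: is_cvg_cst.
  apply: normed_cvg; apply: nondecreasing_is_cvgn.
    by apply/nondecreasing_seqP => n; rewrite /= !seriesEord /= big_ord_recr /= lerDl.
  exists (fine (S x)) => _ [n _ <-]; rewrite -lee_fin fineK //.
  apply: le_trans (nneseries_lim_ge n _); last by move=> k _ _; rewrite lee_fin.
  by rewrite sumEFin lee_fin; apply: ler_sum => k _; exact: db.
pose Xg n x := X n x * \1_(~` M) x.
have Xg_cvg x : cvgn (Xg ^~ x).
  have [xM|xM] := pselect (M x).
    rewrite (_ : Xg ^~ x = cst 0); first exact: is_cvg_cst.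
    by apply/funext => n; rewrite /Xg indicE memNset ?mulr0.
  rewrite (_ : Xg ^~ x = X ^~ x); first exact: X_cvg.
  by apply/funext => n; rewrite /Xg indicE mem_set ?mulr1.
pose Z x := limn (Xg ^~ x).
have mZ : measurable_fun setT Z.
  apply: (@measurable_fun_cvg _ _ _ _ Xg) => [n|x _]; last exact: Xg_cvg.
  apply: measurable_funM; first exact: lift_rv_measurable.
  by apply: measurable_indic; exact: measurableC.
have mZ' : @measurable_fun _ _ (measurableTypeR R) (measurableTypeR R) setT Z.
  exact: mZ.
pose Zmix := @isMeasurableFun.Build _ _ (measurableTypeR R) (measurableTypeR R) Z mZ'.
pose Zf : {mfun measurableTypeR R >-> measurableTypeR R} :=
  MeasurableFun.Pack (MeasurableFun.Class Zmix).
exists (distribution U Zf) => h hc [B hB].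
have mh : measurable_fun setT h by exact: continuous_measurable_fun.
have B_int : U.-integrable setT (cst B%:E) by exact: finite_measure_integrable_cst.
have mhZ : measurable_fun setT (fun x => (h (Z x))%:E).
  by apply/measurable_EFinP; apply: measurableT_comp.
have hX_cvg : {ae U, forall x, setT x -> (h (X n x))%:E @[n --> \oo] --> (h (Z x))%:E}.
  exists M; split => // x /= nx; apply: contrapT => xM; apply: nx => _.
  apply: cvg_EFin; first exact: nearW.
  apply: continuous_cvg; first exact: hc.
  have -> : Z x = limn (X ^~ x).
    congr (limn _); apply/funext => n.
    by rewrite /Xg indicE mem_set ?mulr1.
  exact: X_cvg.
have [|||||int_hZ _ cvg_int] := @dominated_convergence _ _ R U setT measurableT
  (fun n x => (h (X n x))%:E) (fun x => (h (Z x))%:E) (cst B%:E).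
- move=> n; apply/measurable_EFinP; apply: measurableT_comp => //.
  exact: lift_rv_measurable.
- exact: mhZ.
- exact: hX_cvg.
- exact: B_int.
- by apply: aeW => x n _; rewrite lee_fin.
have fin_hZ : (\int[U]_x (h (Z x))%:E)%E \is a fin_num by exact: integrable_fin_num.
rewrite /Rintegral.
have -> : (\int[distribution U Zf]_x (h x)%:E = \int[U]_x (h (Z x))%:E)%E.
  apply: (@integral_distribution _ _ _ _ _ U Zf (EFin \o h)) => //.
  exact/measurable_EFinP.
have : (fun k => (\sum_(w : Om k) P w * h (Y k w))%:E) @ \oo -->
    (fine (\int[U]_x (h (Z x))%:E)%E)%:E.
  rewrite fineK //; apply: cvg_trans cvg_int; apply: near_eq_cvg.
  by apply: nearW => k; rewrite /= integral_comp_lift_rv.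
by move/fine_cvg.
Qed.

End Tower.

(** * The limit law *)

(** The mass of the nonpositive numbers is at most every Laplace transform,
    the negative part being cut off so that the integrand is bounded. *)
Lemma laplace_null (R : realType) (mu : probability (measurableTypeR R) R)
    (lam : nat -> R) (q : R) : 0 <= q < 1 -> (forall m, 0 <= lam m) ->
  (forall m, \int[mu]_x expR (- (lam m * Num.max x 0)) <= q ^+ m) ->
  mu [set` `]0%R, +oo[%R] = 1%E.
Proof.
move=> q01 lam0 hq; pose A : set (measurableTypeR R) := [set` `]-oo, (0 : R)]].
have mA : measurable A by exact: measurable_itv.
have -> : [set` `]0%R, +oo[%R] = ~` A by rewrite /A setCitvl.
rewrite probability_setC //.
suff -> : mu A = 0%E by rewrite sube0.
have muA : mu A \is a fin_num by exact: fin_num_measure.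
rewrite -(fineK muA); congr EFin; apply/le_anti.
rewrite fine_ge0 // andbT; apply: (@le0_geometric _ _ 1 q) => // m.
rewrite mul1r; apply: le_trans (hq m).
pose h (x : R) := expR (- (lam m * Num.max x 0)).
have h0 x : 0 <= h x by exact: expR_ge0.
have mh : measurable_fun setT h.
  apply: measurableT_comp => //; apply: measurableT_comp => //.
  apply: measurable_funM; first exact: measurable_cst.
  by apply: measurable_maxr.
have mhE : measurable_fun (setT : set (measurableTypeR R)) (fun x => (h x)%:E).
  exact/measurable_EFinP.
have h_fin : (\int[mu]_x (h x)%:E)%E \is a fin_num.
  rewrite ge0_fin_numE; last by apply: integral_ge0 => x _; rewrite lee_fin.
  apply: (@le_lt_trans _ _ (\int[mu]_x (cst 1%:E x))%E); last first.
    by rewrite integral_cst //= probability_setT mule1 ltry.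
  apply: ge0_le_integral => //.
  - by move=> x _; rewrite lee_fin.
  - move=> x _; rewrite lee_fin /h -[leRHS]expR0 ler_expR oppr_le0.
    by rewrite mulr_ge0 // le_max lexx orbT.
rewrite -lee_fin fineK // fineK //.
rewrite -[A]setIT -integral_indic //; apply: ge0_le_integral => //.
  by apply/measurable_EFinP; exact: measurable_indic.
move=> x _; rewrite lee_fin indicE; case: (boolP (x \in A)) => xA; last exact: h0.
have x0 : x <= 0 by move: xA; rewrite /A mem_setE in_itv.
by rewrite (max_idPr x0) mulr0 oppr0 expR0.
Qed.

Theorem theorem7p4 (R : realType) (G1 : ograph)
  (G1_simple : simple_graph G1)
  (G1_connected : connected_graph G1)
  (G1_dist : (1 < gdist (ra G1) (rb G1))%N)
  (G1_paths : two_edge_disjoint_paths (ra G1) (rb G1))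
  (pstar : R) (pstar01 : 0 < pstar < 1)
  (pstar_fixed : cross_prob G1 pstar = pstar)
  (df : R) (df_PF : is_PF_eigenvalue (mean_matrix G1 pstar) df) :
  exists mu : probability (measurableTypeR R) R,
    mu [set` `]0%R, +oo[%R] = 1%E /\
    cvg_in_distribution (G := hgraph G1) pstar
      (fun k w => #|root_cluster w|%:R / df ^+ k) mu.
Proof.
have [rho [C [g [c [rho2 g01 c0 C0 hy]]]]] :=
  mean_cluster_growth pstar01 G1_connected G1_dist G1_paths pstar_fixed.
have dfE := growth_rate_eigenvalue pstar01 df_PF rho2 g01 c0 C0 hy.
rewrite {df df_PF}dfE.
have ab := dist_gt1_neq G1_dist.
have clusterE k (w : {set edge (hgraph G1 k)}) :
    #|root_cluster w|%:R = type_sum (@alive_indicator R) (true, true) w.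
  rewrite -sum1_card natr_sum big_mkcond; apply: eq_bigr => e _.
  by rewrite in_root_cluster /alive_indicator; case: alive.
have [K [eta [K0 eta01 incr]]] := increment_le pstar01 G1_dist pstar_fixed rho2 g01 C0 hy.
pose Om k : finType := {set edge (hgraph G1 k)}.
pose proj k (W : Om k.+1) : Om k := coarsen (fibres W).
pose Y k (w : Om k) : R := #|root_cluster w|%:R / rho ^+ k.
have YE k (w : Om k) : Y k w = type_sum (@alive_indicator R) (true, true) w / rho ^+ k.
  by rewrite /Y clusterE.
have Y_ge0 k (w : Om k) : 0 <= Y k w.
  by rewrite divr_ge0 ?ler0n // exprn_ge0 //; lra.
have [mu mu_lim] : exists mu : probability (measurableTypeR R) R, forall h : R -> R,
    continuous h -> (exists B : R, forall x, `|h x| <= B) ->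
    \sum_(w : Om k) perc_weight pstar w * h (Y k w) @[k --> \oo] --> \int[mu]_x h x.
  apply: (@tower_limit R Om (fun k => @perc_weight R (hgraph G1 k) pstar)
    proj _ _ _ Y K eta) => //.
  - by move=> k w; apply: ltW; exact: perc_weight_gt0.
  - exact: sum_perc_weight.
  - move=> k w.
    have := perc_expect_coarsen pstar01 pstar_fixed (fun v => (v == w)%:R : R).
    rewrite /perc_expect [in RHS](bigD1 w) //= eqxx mulr1 [in RHS]big1 ?addr0.
      move=> <-; rewrite big_mkcond; apply: eq_bigr => v _.
      by rewrite /proj; case: (_ == _); rewrite ?mulr1 ?mulr0.
    by move=> v /negbTE ->; rewrite mulr0.
  - by move=> k; apply: le_trans (incr k); apply: ler_sum => W _; rewrite !YE.
exists mu; split; last by move=> h hc hB; exact: mu_lim.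
have [kap [q [kap0 q01 lap]]] := laplace_small pstar01 G1_dist G1_paths
  pstar_fixed rho2 c0 C0 hy.
have rho0 : 0 < rho by lra.
have lam0 m : 0 <= kap * rho ^+ m by rewrite mulr_ge0 ?exprn_ge0 // ltW.
apply: (laplace_null q01 lam0) => m.
pose h (x : R) := expR (- (kap * rho ^+ m * Num.max x 0)).
have hc : continuous h.
  move=> x; apply: continuous_comp; last exact: continuous_expR.
  apply: continuousN; apply: continuousM; first exact: cst_continuous.
  by apply: continuous_max => //; exact: cst_continuous.
have hB : exists B : R, forall x, `|h x| <= B.
  exists 1 => x; rewrite ger0_norm ?expR_ge0 // -[leRHS]expR0 ler_expR oppr_le0.
  by rewrite mulr_ge0 // le_max lexx orbT.
have lim := mu_lim h hc hB.
rewrite -(cvg_lim _ lim) //; apply: limr_le; first exact: cvgP lim.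
exists m => // k mk; apply: le_trans (lap m k mk); apply: ler_sum => w _.
by rewrite /h (max_idPl (Y_ge0 k w)) YE.
Qed.
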